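(* Let $\mathbb{F}$ be a field, $n\ge1$, and let $\mathcal{F},\mathcal{F}'$ be two flags in $\mathbb{F}^n$ of the same length $r>2$. Put $S=\varphi(\mathcal{F})$ and $T=\varphi(\mathcal{F}')$. (1) If $\mathbb{F}$ is infinite and $\mathrm{sig}(\mathcal{F})=(k,1,l)$ with $k,l>1$, then $S\cong T$ if and only if $\mathrm{sig}(\mathcal{F}')=(k',1,l')$ for some $k',l'>1$. (2) If $\mathbb{F}$ is infinite and $\mathrm{sig}(\mathcal{F})$ is not of the form $(k,1,l)$ with $k,l>1$, then $S\cong T$ if and only if $\mathrm{sig}(\mathcal{F})=\mathrm{sig}(\mathcal{F}')$. (3) If $\mathbb{F}$ is finite, then $S\cong T$ if and only if $\mathrm{sig}(\mathcal{F})=\mathrm{sig}(\mathcal{F}')$.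
   Context: $M(n,\mathbb{F})$ is the semigroup of $n\times n$ matrices over $\mathbb{F}$, identified with linear operators on $\mathbb{F}^n$. A flag in $\mathbb{F}^n$ of length $k$ is a chain $\mathcal{F}: 0=V_0\subsetneq V_1\subsetneq\cdots\subsetneq V_k=\mathbb{F}^n$ of subspaces; its signature is $\mathrm{sig}(\mathcal{F})=(d_1,\dots,d_k)$ with $d_i=\dim(V_i/V_{i-1})$. $\varphi(\mathcal{F})=\{a\in M(n,\mathbb{F}) : a(V_i)\subseteq V_{i-1}\text{ for all } i=1,\dots,k\}$. $\cong$ denotes isomorphism of semigroups. *)

(* Defs.v *)
From HB Require Import structures.
From mathcomp Require Import all_boot all_order all_algebra.
Set Implicit Arguments. Unset Strict Implicit. Unset Printing Implicit Defensive.
Import GRing.Theory.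
Local Open Scope ring_scope.

(* Subspaces of F^n are represented by row spaces of n x n matrices
   (mxalgebra); vectors are row vectors and a matrix a acts by x |-> x *m a. *)

Definition is_flag (F : fieldType) (n k : nat) (V : nat -> 'M[F]_n) : Prop :=
  \rank (V 0%N) = 0%N /\ row_full (V k) /\
  (forall i, (i < k)%N -> (V i < V i.+1)%MS).

Definition sig (F : fieldType) (n k : nat) (V : nat -> 'M[F]_n) : seq nat :=
  [seq (\rank (V i) - \rank (V i.-1))%N | i <- iota 1 k].

Definition phi (F : fieldType) (n k : nat) (V : nat -> 'M[F]_n) (a : 'M[F]_n)
  : Prop := forall i, (i < k)%N -> (V i.+1 *m a <= V i)%MS.

Definition semigroup_iso (F : fieldType) (n : nat)
  (S T : 'M[F]_n -> Prop) : Prop :=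
  exists f : 'M[F]_n -> 'M[F]_n,
    (forall a, S a -> T (f a)) /\
    (forall a b, S a -> S b -> f a = f b -> a = b) /\
    (forall c, T c -> exists2 a, S a & f a = c) /\
    (forall a b, S a -> S b -> f (a *m b) = f a *m f b).

Definition finite_field (F : fieldType) : Prop :=
  exists s : seq F, forall x : F, x \in s.

Definition sig_k1l (s : seq nat) : Prop :=
  exists k l : nat, (1 < k)%N /\ (1 < l)%N /\ s = [:: k; 1%N; l].

(* Main.v *)
Require Import Defs.
From HB Require Import structures.
From mathcomp Require Import all_boot all_order all_algebra.
From mathcomp Require Import boolp classical_sets functions cardinality.
From mathcomp Require Import zify.
Set Implicit Arguments. Unset Strict Implicit. Unset Printing Implicit Defensive.
Import GRing.Theory.
Local Open Scope ring_scope.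

(* Matrices act on row vectors on the right.  Put [d_i = dim V_i / V_(i-1)].

   Products of [j] elements of [S] have image in [V_(r-j)], and elements of [S]
   kill [V_1].  So if [a_i] are such products, [b_k] lie in [S] and
   [a_i b_k <> 0] exactly when [i = k], the number of indices is at most
   [dim V_(r-j) / V_1], and this bound is attained: [d_2, ..., d_(r-1)] are
   invariants of [S].  Since [n] is given, only [d_1] remains to be found.

   If [m = dim V_(r-1) / V_1 >= 2], let [A] be the set of [a] with [S a = 0] and
   [B] the set of [b] with [b S = 0].  On [B], divisibility on the right by
   elements of [A] orders the subspaces [V_(r-1) b] by inclusion; these are all
   the subspaces of [V_1] of dimension at most [m].  As [m >= 2], this order
   knows the lines through points of the projective space of [V_1], hence [d_1].

   If [m = 1] then [r = 3] and [d_2 = 1], and [a b] is the product of a column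
   [p a] and a row [q b], where [p] and [q] range over spaces of dimensions
   [d_3] and [d_1].  Whether [d_1 = 1] and whether [d_3 = 1] can be read off the
   multiplication, and over a finite field [#|S b|] gives [d_3].  If [F] is
   infinite and [d_1, d_3 > 1], all projective spaces involved have [#|F|]
   points (by [#|F * F| = #|F|]), so homogeneous bijections between the spaces
   of columns and of rows exist and produce an isomorphism. *)

(** * Squares of infinite sets *)

Section InfiniteSquare.
Local Open Scope nat_scope.
Local Open Scope classical_set_scope.

Lemma total_bigcup2 (T : Type) (F : set (set T)) (p q : T) :
  total_on F subset -> (\bigcup_(X in F) X) p -> (\bigcup_(X in F) X) q ->
  exists X, [/\ F X, X p & X q].
Proof.
move=> totF [X FX Xp] [Y FY Yq].
by case: (totF X Y FX FY) => sXY; [exists Y | exists X]; split=> //; apply: sXY.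
Qed.

(** Zorn's lemma on partial bijections between [A] and [C], ordered by inclusion: a maximal one that
    missed some [a] in [A] and some [c] in [C] could be enlarged by [(a, c)], so it is total on one
    side. *)
Lemma set_inj_comparable (T : Type) (A C : set T) :
  (exists j : T -> T, set_fun A C j /\ set_inj A j) \/
  (exists j : T -> T, set_fun C A j /\ set_inj C j).
Proof.
pose P (G : set (T * T)) := (forall p, G p -> A p.1 /\ C p.2) /\
  (forall p q, G p -> G q -> (p.1 = q.1 <-> p.2 = q.2)).
have [|G [[GAC Ginj] Gmax]] := @Zorn_bigcup _ P.
  move=> F FP totF; split=> [p [X FX]|p q Up Uq]; first exact: (FP X FX).1.
  by have [X [FX Xp Xq]] := total_bigcup2 totF Up Uq; apply: (FP X FX).2.
have [totA|/existsNP[a /not_implyP[Aa Na]]] :=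
    lem (forall x, A x -> exists y, G (x, y)).
  left; have /choice[j jP] (x : T) : exists y, A x -> G (x, y).
    have [/totA[y]|] := lem (A x); first by exists y.
    by exists x.
  exists j; split=> [x /jP/GAC[]//|x y].
  by rewrite !inE => /jP Gx /jP Gy jxy; apply/(Ginj _ _ Gx Gy).
have [totC|/existsNP[c /not_implyP[Cc Nc]]] :=
    lem (forall y, C y -> exists x, G (x, y)).
  right; have /choice[j jP] (y : T) : exists x, C y -> G (x, y).
    have [/totC[x]|] := lem (C y); first by exists x.
    by exists y.
  exists j; split=> [x /jP/GAC[]//|x y].
  by rewrite !inE => /jP Gx /jP Gy jxy; apply/(Ginj _ _ Gx Gy).
exfalso; apply: (Gmax (G `|` [set (a, c)])).
  by split=> [p|/(_ (a, c)) GG]; [left | apply: Na; exists c; apply: GG; right].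
split=> [p [/GAC//|->]//|p q [Gp|->] [Gq|->]] //=; first exact: Ginj.
- split=> [pa|pc].
    by case: Na; exists p.2; rewrite -pa -surjective_pairing.
  by case: Nc; exists p.1; rewrite -pc -surjective_pairing.
- split=> [pa|pc].
    by case: Na; exists q.2; rewrite pa -surjective_pairing.
  by case: Nc; exists q.1; rewrite pc -surjective_pairing.
Qed.

Section Square.
Variables (T : Type) (iota : nat -> T).
Hypothesis iota_inj : injective iota.

(** The domain of a [square] relation is a full square, so its side can be read off the diagonal. *)
Let dom (G : set (T * T * T)) : set T := [set x | exists z, G (x, x, z)].

(** Graphs of injections of [dom G * dom G] into [dom G]. The last clause makes [dom G] infinite as
    soon as [G] is nonempty, while still admitting the empty relation, which is the union of the
    empty chain. *)
Let square (G : set (T * T * T)) :=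
  [/\ forall x y z, G (x, y, z) -> [/\ dom G x, dom G y & dom G z],
      forall x y, dom G x -> dom G y -> exists z, G (x, y, z),
      forall p q, G p -> G q -> (p.1 = q.1 <-> p.2 = q.2) &
      forall p k, G p -> dom G (iota k)].

(* A maximal partial injection [A * A -> A] with [A] infinite has [A] as large
   as [T]: otherwise a copy [B] of [A] sits in the complement, and the three
   new quarters of the square of [A `|` B] can be sent into [B]. *)
Lemma square_inj : exists f : T * T -> T, injective f.
Proof.
have [|G [[Gd Gt Ginj Gi] Gmax]] := @Zorn_bigcup _ square.
  move=> F FP totF.
  have domU X x : F X -> dom X x -> dom (\bigcup_(X in F) X) x.
    by move=> FX [z Xz]; exists z, X.
  split=> [x y z [X FX] Xxyz|x y [z Uz] [t Ut]|p q Up Uq|p k [X FX Xp]].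
  - by have [/(_ _ _ _ Xxyz)[? ? ?] _ _ _] := FP X FX; split; apply: domU FX _.
  - have [X [FX Xp Xq]] := total_bigcup2 totF Uz Ut.
    have [_ tX _ _] := FP X FX.
    have [||u Xu] := tX x y; [by exists z | by exists t | by exists u, X].
  - by have [X [FX Xp Xq]] := total_bigcup2 totF Up Uq; have [_ _ Xinj _] := FP X FX; apply: Xinj.
  - by have [_ _ _ /(_ p k Xp)] := FP X FX; apply: domU FX.
pose A := dom G.
have Ai k : A (iota k).
  have [[p Gp]|/forallNP G0] := lem (exists p, G p); first exact: Gi Gp.
  (* An empty [G] is not maximal: the pairing function of [nat], transported by [iota], is a larger
     relation. *)
  exfalso; pose G0' := [set (iota n, iota m, iota (pickle (n, m))) | n in setT & m in setT].
  have domG0' n : dom G0' (iota n) by exists (iota (pickle (n, n))), n => //; exists n.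
  apply: (Gmax G0').
    split=> [p /G0//|]; move=> /(_ (iota 0, iota 0, iota (pickle (0, 0)))) GG.
    by apply: (G0 _ (GG _)); exists 0 => //; exists 0.
  split.
  - by move=> x y z [n _ [m _ [<- <- <-]]]; split; apply: domG0'.
  - move=> x y [z [n _ [m _ [<- _ _]]]] [t [n' _ [m' _ [<- _ _]]]].
    by exists (iota (pickle (n, n'))), n => //; exists n'.
  - move=> _ _ [n _ [m _ <-]] [n' _ [m' _ <-]] /=; split.
      by case=> /iota_inj -> /iota_inj ->.
    by move=> /iota_inj /(pcan_inj pickleK)[-> ->].
  - by move=> p k' _; apply: domG0'.
have /choice[g gP] (p : T * T) : exists z, A p.1 -> A p.2 -> G (p.1, p.2, z).
  have [[/Gt Ap /Ap[z]]|NA] := lem (A p.1 /\ A p.2); first by exists z.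
  by exists p.1 => A1 A2; case: NA.
have gA x y : A x -> A y -> A (g (x, y)).
  by move=> Ax Ay; have /Gd[] := gP (x, y) Ax Ay.
have g_inj x y x' y' : A x -> A y -> A x' -> A y' -> g (x, y) = g (x', y') ->
    x = x' /\ y = y'.
  move=> Ax Ay Ax' Ay' gg.
  by have /= [_ /(_ gg)[]] := Ginj _ _ (gP (x, y) Ax Ay) (gP (x', y') Ax' Ay').
have [[j [jC j_inj]]|[j [jA j_inj]]] := set_inj_comparable A (~` A); last first.
  have {}j_inj x y : ~ A x -> ~ A y -> j x = j y -> x = y.
    by move=> Nx Ny; apply: j_inj; rewrite inE.
  have {}jA x : ~ A x -> A (j x) by apply: jA.
  (* All of [T] fits in [A]: the tags [iota 0] and [iota 1] keep the images of [A] and of its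
     complement disjoint. *)
  pose h x := if `[< A x >] then g (x, iota 0) else g (j x, iota 1).
  have hA x : A (h x).
    by rewrite /h; case: asboolP => Ax; apply: gA => //; apply: jA.
  have h_inj : injective h.
    move=> x y; rewrite /h; case: asboolP => Ax; case: asboolP => Ay.
    + by move=> /g_inj[] //.
    + by move=> /g_inj[] //; [apply: jA | move=> _ /iota_inj].
    + by move=> /g_inj[] //; [apply: jA | move=> _ /iota_inj].
    + by move=> /g_inj[] //; [apply: jA | apply: jA | move=> /j_inj ->].
  exists (fun p => g (h p.1, h p.2)) => -[x y] [x' y'] /= /g_inj[] //.
  by move=> /h_inj -> /h_inj ->.
exfalso.
have {}j_inj x y : A x -> A y -> j x = j y -> x = y.
  by move=> Nx Ny; apply: j_inj; rewrite inE.
(* [e] selects [A] or its copy [j A], and [c s t] labels the quarters of the enlarged square; the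
   three new ones are those with [s || t]. *)
pose e (s : bool) x := if s then j x else x.
pose c (s t : bool) := iota (s.*2 + t).
pose new : set (T * T * T) := [set p | exists a b s t,
  [/\ A a, A b, s || t & p = (e s a, e t b, j (g (g (a, b), c s t)))]].
have gcA a b s t : A a -> A b -> A (g (g (a, b), c s t)).
  by move=> Aa Ab; apply: gA (gA _ _ Aa Ab) (Ai _).
have e_inj s t x y : A x -> A y -> e s x = e t y -> s = t /\ x = y.
  move=> Ax Ay; case: s t => [] [] /=.
  - by move/j_inj=> ->.
  - by move=> E; case: (jC _ Ax); rewrite E.
  - by move=> E; case: (jC _ Ay); rewrite -E.
  - by [].
have oldnew a b s t z : A a -> A b -> s || t -> G (e s a, e t b, z) -> False.
  move=> Aa Ab st /Gd[Da Db _].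
  by case: s st Da => [_ /(jC _ Aa)//|/= tt _]; move: Db; rewrite tt => /(jC _ Ab).
have domnew x : dom (G `|` new) x <-> exists s a, A a /\ x = e s a.
  split=> [[z [Gz|[a [b [s [t [Aa Ab _ [-> _ _]]]]]]]]|[s [a [Aa ->]]]].
  - by exists false, x; split=> //; exists z.
  - by exists s, a.
  - case: s; last by have [z Gz] := Gt a a Aa Aa; exists z; left.
    by exists (j (g (g (a, a), c true true))); right; exists a, a, true, true.
apply: (Gmax (G `|` new)).
  split=> [p Gp|sub]; first by left.
  apply: (oldnew _ _ true true _ (Ai 0) (Ai 0) isT); apply: sub.
  by right; exists (iota 0), (iota 0), true, true.
split.
- move=> x y z [/Gd[Ax Ay Az]|[a [b [s [t [Aa Ab _ [-> -> ->]]]]]]].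
    by split; apply/domnew; [exists false, x | exists false, y | exists false, z].
  split; apply/domnew; [by exists s, a | by exists t, b |].
  by exists true, (g (g (a, b), c s t)); split=> //; apply: gcA.
- move=> x y /domnew[s [a [Aa ->]]] /domnew[t [b [Ab ->]]].
  have [st|] := boolP (s || t).
    by exists (j (g (g (a, b), c s t))); right; exists a, b, s, t.
  by case: s t => [] [] // _; have [z Gz] := Gt a b Aa Ab; exists z; left.
- move=> p q [Gp|[a [b [s [t [Aa Ab st ->]]]]]] [Gq|[a' [b' [s' [t' [Aa' Ab' st' ->]]]]]] /=.
  + exact: Ginj.
  + case: p Gp => [[x y] z] Gp /=; split=> E; exfalso.
      by move: Gp; rewrite E; apply: oldnew.
    by have [_ _] := Gd _ _ _ Gp; rewrite E; apply: jC; apply: gcA.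
  + case: q Gq => [[x y] z] Gq /=; split=> E; exfalso.
      by move: Gq; rewrite -E; apply: oldnew.
    by have [_ _] := Gd _ _ _ Gq; rewrite -E; apply: jC; apply: gcA.
  + split; first by case=> /e_inj[] // -> -> /e_inj[] // -> ->.
    move=> /j_inj E; have /g_inj[] := E (gcA _ _ _ _ Aa Ab) (gcA _ _ _ _ Aa' Ab').
    * exact: gA.
    * exact: Ai.
    * exact: gA.
    * exact: Ai.
    move=> /g_inj[] // -> -> /iota_inj.
    by case: s {st E} => [] /=; case: t => [] /=; case: s' {st'} => []; case: t' => [].
- move=> p k _; apply/domnew; exists false, (iota k); split=> //; exact: Ai.
Qed.

End Square.
End InfiniteSquare.

(** * Cardinalities over an infinite field *)

Lemma card_le_set_inj (T : Type) (U : choiceType) (u0 : U) (A : set T) (B : set U) :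
  (A #<= B)%card -> exists f : T -> U, set_fun A B f /\ set_inj A f.
Proof.
pose U0 : pointedType := HB.pack U (isPointed.Build U u0).
by move=> /(@pcard_leP T U0)/injfunPex[f]; exists f.
Qed.

Lemma card_eq_set_bij (T : Type) (U : choiceType) (u0 : U) (A : set T) (B : set U) :
  (A #= B)%card -> exists f : T -> U, set_bij A B f.
Proof.
pose U0 : pointedType := HB.pack U (isPointed.Build U u0).
by move=> /(@card_set_bijP T U0).
Qed.

Section LinearAlgebra.
Variable F : fieldType.

Lemma rank_gt1 m n (U : 'M[F]_(m, n)) : (1 < \rank U)%N ->
  exists x y : 'rV_n, [/\ (x <= U)%MS, (y <= U)%MS &
    forall a b, a *: x + b *: y = 0 -> a = 0 /\ b = 0].
Proof.
move=> U1; pose i := Ordinal (ltnW U1); pose j := Ordinal U1.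
have rU k : (row k (row_base U) <= U)%MS.
  by apply: submx_trans (row_sub _ _) _; rewrite eq_row_base.
exists (row i (row_base U)), (row j (row_base U)); split=> // a b.
rewrite !rowE !scalemxAl -mulmxDl => /eqP.
rewrite mulmx_free_eq0 ?row_base_free // => /eqP E.
have := congr1 (fun v : 'rV_ _ => v 0 i) E; have := congr1 (fun v : 'rV_ _ => v 0 j) E.
by rewrite !mxE /= !mulr0 !mulr1 addr0 add0r.
Qed.

(** A normalisation device: it is homogeneous of degree one and vanishes only at [0], so each line
    contains exactly one vector of value [1]. *)
Definition first_coef n (v : 'rV[F]_n) : F :=
  if [pick j | v 0 j != 0] is Some j then v 0 j else 0.

Lemma first_coef_eq0 n (v : 'rV[F]_n) : (first_coef v == 0) = (v == 0).
Proof.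
rewrite /first_coef; case: pickP => [j vj|v0].
  rewrite (negPf vj); apply/esym/negbTE; apply: contraNneq vj => ->.
  by rewrite mxE.
rewrite eqxx; apply/esym/eqP/rowP => j.
by rewrite mxE; have /negbFE/eqP := v0 j.
Qed.

Lemma first_coefZ n t (v : 'rV[F]_n) : first_coef (t *: v) = t * first_coef v.
Proof.
have [->|t0] := eqVneq t 0.
  by rewrite mul0r scale0r; apply/eqP; rewrite first_coef_eq0.
rewrite /first_coef (@eq_pick _ _ (fun j => v 0 j != 0)).
  by case: pickP => [j _|_]; rewrite ?mulr0 // mxE.
by move=> j; rewrite mxE mulf_eq0 (negPf t0).
Qed.

Hypothesis Finf : ~ finite_field F.

Lemma infinite_field_square : exists f : F * F -> F, injective f.
Proof.
have /infiniteP/(card_le_set_inj 0)[f [_ finj]] : infinite_set [set: F].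
  move=> /finite_seqP[s sE]; apply: Finf; exists s => x.
  by have : [set: F]%classic x by []; rewrite sE.
apply: (@square_inj _ f) => i j; apply: finj; exact: mem_set.
Qed.

Lemma infinite_field_row (k : nat) : exists f : (nat -> F) -> F,
  forall u v, f u = f v -> forall i, (i < k)%N -> u i = v i.
Proof.
have [g ginj] := infinite_field_square.
elim: k => [|k [f fP]]; first by exists (fun=> 0).
exists (fun u => g (f u, u k)) => u v /ginj[/fP fuv uvk] i.
by rewrite ltnS leq_eqVlt => /predU1P[->|/fuv].
Qed.

Lemma infinite_field_matrix m n : exists f : 'M[F]_(m, n) -> F, injective f.
Proof.
have [f fP] := infinite_field_row (m * n).
pose u (a : 'M[F]_(m, n)) i :=
  if insub i is Some j then mxvec a 0 j else (0 : F).
exists (f \o u) => a b /fP ab; apply: (can_inj mxvecK); apply/rowP => j.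
by have := ab j (ltn_ord j); rewrite /u valK.
Qed.

(** Both sets contain a copy of [F], and every matrix space injects into [F]; Cantor-Bernstein
    concludes. *)
Lemma infinite_set_bij m n p q (A : set 'M[F]_(m, n)) (B : set 'M[F]_(p, q)) :
  (exists2 f : F -> 'M_(m, n), injective f & forall t, A (f t)) ->
  (exists2 f : F -> 'M_(p, q), injective f & forall t, B (f t)) ->
  exists h : 'M_(m, n) -> 'M_(p, q), set_bij A B h.
Proof.
have le k l k' l' (X : set 'M[F]_(k, l)) (Y : set 'M[F]_(k', l')) :
    (exists2 f : F -> 'M_(k', l'), injective f & forall t, Y (f t)) ->
    (X #<= Y)%card.
  case=> f finj Yf; have [g ginj] := infinite_field_matrix k l.
  suff [h] : $|{injfun X >-> Y}| by exact: inj_card_le.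
  apply/injfunPex; exists (f \o g) => [x Xx|]; first exact: Yf.
  by move=> x y _ _ /finj/ginj.
by move=> Af Bf; apply/(card_eq_set_bij 0)/Cantor_Bernstein; apply: le.
Qed.

(** Points of the two projective spaces are represented by vectors with [first_coef] equal to [1].
    Both sets of points have the cardinality of [F], so a bijection exists, and it extends along
    each line by homogeneity; additivity is not asked for. *)
Lemma homogeneous_bij n (U U' : 'M[F]_n) :
  (1 < \rank U)%N -> (1 < \rank U')%N -> exists h : 'rV[F]_n -> 'rV[F]_n,
  [/\ forall v, (v <= U)%MS -> (h v <= U')%MS,
      forall t v, h (t *: v) = t *: h v,
      forall v w, (v <= U)%MS -> (w <= U)%MS -> h v = h w -> v = w &
      forall w, (w <= U')%MS -> exists2 v, (v <= U)%MS & h v = w].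
Proof.
pose N (W : 'M[F]_n) := [set v : 'rV[F]_n | (v <= W)%MS /\ first_coef v = 1]%classic.
have Ninf W : (1 < \rank W)%N ->
    exists2 f : F -> 'rV_n, injective f & forall t, N W (f t).
  move=> /rank_gt1[x [y [xW yW xy]]].
  have xty t : first_coef (x + t *: y) != 0.
    rewrite first_coef_eq0; apply/eqP => E; have [] := xy 1 t.
      by rewrite scale1r.
    by move/eqP; rewrite oner_eq0.
  (* The points other than [y] of the projective line through [x] and [y] are indexed by [F]. *)
  exists (fun t => (first_coef (x + t *: y))^-1 *: (x + t *: y)) => [s t|t].
    set c := first_coef _; set d := first_coef _ => /eqP.
    rewrite -subr_eq0 !scalerDr !scalerA opprD addrACA -!scalerBl => /eqP/xy[].
    move=> /subr0_eq-> /subr0_eq/mulfI; apply; rewrite invr_eq0; exact: xty.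
  split; first by rewrite scalemx_sub ?addmx_sub ?scalemx_sub.
  by rewrite first_coefZ mulVf.
move=> /Ninf NU /Ninf NU'; have [s [sN sinj ssurj]] := infinite_set_bij NU NU'.
have norm W v : (v <= W)%MS -> v != 0 -> N W ((first_coef v)^-1 *: v).
  move=> vW v0; split; first exact: scalemx_sub.
  by rewrite first_coefZ mulVf ?first_coef_eq0.
(* At [v = 0] the outer factor is [0], whatever [s] does there. *)
pose h v := first_coef v *: s ((first_coef v)^-1 *: v).
have h0 : h 0 = 0.
  suff /eqP c0 : first_coef (0 : 'rV[F]_n) == 0 by rewrite /h c0 scale0r.
  by rewrite first_coef_eq0.
have hcoef v : (v <= U)%MS -> first_coef (h v) = first_coef v.
  have [-> _|v0 vU] := eqVneq v 0; first by rewrite h0.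
  by have [_] := sN _ (norm _ _ vU v0); rewrite /h first_coefZ => ->; rewrite mulr1.
exists h; split.
- move=> v vU; have [->|v0] := eqVneq v 0; first by rewrite h0 sub0mx.
  by have [? _] := sN _ (norm _ _ vU v0); apply: scalemx_sub.
- move=> t v; have [->|t0] := eqVneq t 0; first by rewrite !scale0r.
  by rewrite /h first_coefZ invfM !scalerA mulrAC mulVf // mul1r.
- move=> v w vU wU E.
  have cE : first_coef v = first_coef w by rewrite -(hcoef v vU) E hcoef.
  have [v0|v0] := eqVneq v 0.
    by apply/eqP; rewrite v0 eq_sym -first_coef_eq0 -cE first_coef_eq0 v0.
  have w0 : w != 0 by rewrite -first_coef_eq0 -cE first_coef_eq0.
  have c0 : first_coef v != 0 by rewrite first_coef_eq0.
  have := sinj _ _ (mem_set (norm _ _ vU v0)) (mem_set (norm _ _ wU w0)).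
  move: E; rewrite /h -cE => /(scalerI c0) E /(_ E); apply: scalerI.
  by rewrite invr_eq0.
- move=> w wU; have [->|w0] := eqVneq w 0; first by exists 0; rewrite ?sub0mx.
  have [v [vU v1] sv] := ssurj _ (norm _ _ wU w0).
  exists (first_coef w *: v); first exact: scalemx_sub.
  have c0 : first_coef w != 0 by rewrite first_coef_eq0.
  by rewrite /h first_coefZ v1 mulr1 !scalerA mulVf // scale1r sv scalerA mulfV ?scale1r.
Qed.

End LinearAlgebra.

(** * Flags and conjugacy *)

(** The cokernel matrix of [U] sends [y] to a nonzero row; a nonzero coordinate of that row,
    rescaled, is the functional. *)
Lemma sep_functional (F : fieldType) m n (U : 'M[F]_(m, n)) (y : 'rV_n) :
  ~~ (y <= U)%MS -> exists f : 'cV_n, U *m f = 0 /\ y *m f = 1%:M.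
Proof.
rewrite submxE; have := mulmx_coker U; move: (cokermx U) => K UK.
move=> /rowV0Pn[_ /sub_rVP[c ->]].
rewrite scaler_eq0 negb_or => /andP[_ /rV0Pn[j yj]].
exists (K *m (delta_mx j 0 *m ((y *m K) 0 j)^-1%:M)).
rewrite !mulmxA UK !mul0mx; split=> //.
apply/rowP => k; rewrite -colE !ord1 mul_mx_scalar mxE [RHS]mxE eqxx.
by rewrite [in X in _ * X]mxE mulVf.
Qed.

Section Flag.
Variables (F : fieldType) (n r : nat) (V : nat -> 'M[F]_n).
Hypothesis flagV : is_flag r V.

Lemma flag0 : V 0 = 0.
Proof. by apply/eqP; rewrite -mxrank_eq0 flagV.1. Qed.

Lemma flag_full m (a : 'M_(m, n)) : (a <= V r)%MS.
Proof. by apply: submx_full; have [_ []] := flagV. Qed.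

Lemma flag_ltS i : (i < r)%N -> (V i < V i.+1)%MS.
Proof. by have [_ [_]] := flagV; apply. Qed.

Lemma flag_le i j : (i <= j <= r)%N -> (V i <= V j)%MS.
Proof.
case/andP; elim: j => [|j IHj]; first by rewrite leqn0 => /eqP->.
rewrite leq_eqVlt ltnS => /predU1P[-> //|ij jr].
exact: submx_trans (IHj ij (ltnW jr)) (ltmxW (flag_ltS jr)).
Qed.

Lemma flag_new i : (i < r)%N ->
  exists2 y : 'rV_n, (y <= V i.+1)%MS & ~~ (y <= V i)%MS.
Proof.
move=> /flag_ltS; rewrite ltmxE => /andP[_ /row_subPn[j Nj]].
by exists (row j (V i.+1)); first exact: row_sub.
Qed.

Lemma phi0 : phi r V 0.
Proof. by move=> i _; rewrite mulmx0 sub0mx. Qed.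

Lemma phi_stable a i : phi r V a -> (i <= r)%N -> (V i *m a <= V i)%MS.
Proof.
move=> Sa; case: i => [_|i ir]; first by rewrite flag0 mul0mx sub0mx.
by apply: submx_trans (Sa i ir) (flag_le _); rewrite leqnSn.
Qed.

Lemma phi_mul a b : phi r V a -> phi r V b -> phi r V (a *m b).
Proof.
move=> Sa Sb i ir; rewrite mulmxA.
exact: submx_trans (submxMr _ (Sa i ir)) (phi_stable Sb (ltnW ir)).
Qed.

(** For [i <= j] the image, spanned by [v], already lies in [V j]; for [j < i] the functional [f]
    kills [V j.+1]. These rank one elements are the probes used in all that follows. *)
Lemma phi_rank1 i (f : 'cV_n) (v : 'rV_n) : (i <= r)%N ->
  V i *m f = 0 -> (v <= V i)%MS -> phi r V (f *m v).
Proof.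
move=> ir fV vV j jr; rewrite mulmxA; have [ij|ji] := leqP i j.
  by apply: mulmx_sub; apply: submx_trans vV (flag_le _); rewrite ij ltnW.
have /submxP[D ->] : (V j.+1 <= V i)%MS by apply: flag_le; rewrite ji.
by rewrite -(mulmxA D) fV mulmx0 mul0mx sub0mx.
Qed.

Lemma phi_scale t a : phi r V a -> phi r V (t *: a).
Proof. by move=> Sa i ir; rewrite -scalemxAr scalemx_sub ?Sa. Qed.

Lemma phi_add a b : phi r V a -> phi r V b -> phi r V (a + b).
Proof. by move=> Sa Sb i ir; rewrite mulmxDr addmx_sub ?Sa ?Sb. Qed.

End Flag.

Lemma sig_eqP (F : fieldType) (n r : nat) (V V' : nat -> 'M[F]_n) :
  is_flag r V -> is_flag r V' ->
  (sig r V = sig r V' <-> forall i, (i <= r)%N -> \rank (V i) = \rank (V' i)).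
Proof.
move=> fV fV'; split=> [E|E]; last first.
  apply/eq_in_map => i; rewrite mem_iota add1n ltnS => /andP[i0 ir].
  by rewrite !E ?(leq_trans (leq_pred _)).
elim=> [_|i IHi ir]; first by rewrite fV.1 fV'.1.
have := congr1 (nth 0%N ^~ i) E; rewrite !(nth_map 0%N) ?size_iota //.
rewrite nth_iota //= => Ei.
have rk (W : nat -> 'M[F]_n) : is_flag r W -> \rank (W i.+1) = (\rank (W i.+1) - \rank (W i) + \rank (W i))%N.
  by move=> fW; rewrite subnK // mxrankS // (flag_le fW) // leqnSn.
move: Ei; rewrite !add1n !add0n => Ei.
by rewrite (rk V) // (rk V') // Ei IHi // ltnW.
Qed.

Section Conjugacy.
Variables (F : fieldType) (n r : nat) (V V' : nat -> 'M[F]_n).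
Hypotheses (flagV : is_flag r V) (flagV' : is_flag r V').
Hypothesis eq_rank : forall i, (i <= r)%N -> \rank (V i) = \rank (V' i).

(** Induction on [i]: the map found on [V i] is glued to an isomorphism between complements of [V i]
    in [V i.+1] and of [V' i] in [V' i.+1]. *)
Lemma flag_conj i : (i <= r)%N -> exists2 g : 'M[F]_n, g \in unitmx &
  forall j, (j <= i)%N -> (V j *m g :=: V' j)%MS.
Proof.
elim: i => [_|i IHi ir].
  exists 1%:M => [|j]; first exact: unitmx1.
  by rewrite leqn0 => /eqP->; rewrite !(flag0 flagV, flag0 flagV') mul0mx.
have [g gU gV] := IHi (ltnW ir).
have split_rank (W : nat -> 'M[F]_n) : is_flag r W ->
    \rank (W i.+1) = (\rank (W i) + \rank (W i.+1 :\: W i))%N.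
  move=> fW; rewrite -(mxrank_cap_compl (W i.+1) (W i)); congr (_ + _)%N.
  by apply/eqmx_rank/eqmxP/capmx_idPr; rewrite (flag_le fW) // leqnSn.
have splitV (W : nat -> 'M[F]_n) : is_flag r W -> (W i.+1 :=: W i + (W i.+1 :\: W i))%MS.
  move=> fW; apply: eqmx_trans (eqmx_sym (addsmx_diff_cap_eq (W i.+1) (W i))) _.
  rewrite addsmxC; apply: adds_eqmx => //; apply/capmx_idPr.
  by rewrite (flag_le fW) // leqnSn.
pose C := (V i.+1 :\: V i)%MS.
pose C' := (V' i.+1 :\: V' i)%MS.
have [h _ hC] : {h | h \in unitmx & (C' :=: C *m h)%MS}.
  apply: eq_rank_unitmx; apply/eqP.
  rewrite -(eqn_add2l (\rank (V i))) -(split_rank V) // eq_rank //.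
  by rewrite (eq_rank (ltnW ir)) -split_rank // eq_rank.
have CV0 : (V i :&: C = 0)%MS by rewrite capmxC capmx_diff.
have CV0' : (C :&: V i = 0)%MS by rewrite capmx_diff.
have := fun W : 'M_n => proj_mx_id (W := W) CV0; have := fun W : 'M_n => proj_mx_0 (W := W) CV0.
have := fun W : 'M_n => proj_mx_id (W := W) CV0'; have := fun W : 'M_n => proj_mx_0 (W := W) CV0'.
move: (proj_mx (V i) C) (proj_mx C (V i)) => P Q Q0 Q1 P0 P1.
(* [P] and [Q] are the projections onto [V i] and [C] along each other. *)
pose f := P *m g + Q *m h.
have fVi (W : 'M_n) : (W <= V i)%MS -> W *m f = W *m g.
  by move=> WV; rewrite mulmxDr !mulmxA P1 // Q0 // mul0mx addr0.
have fC : C *m f = C *m h.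
  by rewrite mulmxDr !mulmxA Q1 // P0 // mul0mx add0r.
have fV : (V i.+1 *m f :=: V' i.+1)%MS.
  apply: eqmx_trans (eqmxMr _ (splitV V flagV)) _.
  apply: eqmx_trans (addsmxMr _ _ _) _; rewrite fVi // fC; apply: eqmx_sym.
  apply: eqmx_trans (splitV V' flagV') _; apply: adds_eqmx => //.
  exact/eqmx_sym/gV.
(* [f] is injective on [V i.+1] but may be singular on the whole space; it is replaced by an
   invertible [k] with the same restriction. *)
have [k kU kV] : {k | k \in unitmx & V i.+1 *m f = V i.+1 *m k}.
  by apply: complete_unitmx; rewrite fV eq_rank.
exists k => // j; rewrite leq_eqVlt ltnS => /predU1P[->|ji].
  by rewrite -kV.
have ViS : (V i <= V i.+1)%MS by rewrite (flag_le flagV) // leqnSn.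
have ViW : (V j <= V i)%MS by rewrite (flag_le flagV) // ji ltnW.
have /submxP[D DE] := submx_trans ViW ViS.
by rewrite DE -mulmxA -kV mulmxA -DE fVi //; apply: gV.
Qed.

Lemma semigroup_iso_of_eq_rank : semigroup_iso (phi r V) (phi r V').
Proof.
have [g gU gV] := flag_conj (leqnn r).
have key (W W' : nat -> 'M[F]_n) k : k \in unitmx ->
    (forall j, (j <= r)%N -> (W j *m k :=: W' j)%MS) ->
    forall a, phi r W a -> phi r W' (invmx k *m a *m k).
  move=> kU kW a Wa i ir.
  rewrite !mulmxA -(eqmxMr _ (eqmxMr _ (eqmxMr _ (kW i.+1 ir)))) mulmxK //.
  by rewrite (submx_trans (submxMr _ (Wa i ir))) // kW // ltnW.
have gV' j : (j <= r)%N -> (V' j *m invmx g :=: V j)%MS.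
  move=> jr; apply: eqmx_trans (eqmxMr _ (eqmx_sym (gV j jr))) _.
  by rewrite mulmxK.
exists (fun a => invmx g *m a *m g); split; first exact: key.
split=> [a b _ _ /(can_inj (mulmxK gU))|].
  by move/(can_inj (mulKmx (_ : invmx g \in unitmx))); apply; rewrite unitmx_inv.
split=> [c Tc|a b _ _].
  exists (invmx (invmx g) *m c *m invmx g); last by rewrite invmxK !mulmxA mulVmx // mul1mx mulmxKV.
  by apply: key Tc; rewrite // unitmx_inv.
by rewrite !mulmxA mulmxK.
Qed.

End Conjugacy.

Section Isomorphism.
Variables (F : fieldType) (n : nat).
Implicit Types (S T : 'M[F]_n -> Prop) (f g : 'M[F]_n -> 'M[F]_n).

(** A symmetric form of isomorphism: an inequality between invariants proved in one direction yields
    equality by exchanging [f] and [g]. *)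
Definition mutually_inverse_iso S T f g : Prop :=
  [/\ forall a, S a -> T (f a), forall a, S a -> g (f a) = a &
      forall a b, S a -> S b -> f (a *m b) = f a *m f b] /\
  [/\ forall c, T c -> S (g c), forall c, T c -> f (g c) = c &
      forall c d, T c -> T d -> g (c *m d) = g c *m g d].

Lemma mutually_inverse_isoC S T f g :
  mutually_inverse_iso S T f g -> mutually_inverse_iso T S g f.
Proof. by case. Qed.

End Isomorphism.

(** * Dual families and the middle of the signature *)

(** A basis of a complement of [U] in [W] stays independent modulo [U], so its dual functionals can
    be taken to factor through the cokernel of [U]. *)
Lemma dual_family (F : fieldType) n d (U W : 'M[F]_n) :
  (d + \rank U <= \rank W)%N ->
  exists (x : 'I_d -> 'rV_n) (g : 'I_d -> 'cV_n),
  [/\ forall i, (x i <= W)%MS, forall k, U *m g k = 0 &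
      forall i k, x i *m g k = (i == k)%:R%:M].
Proof.
move=> dW; pose C := (W :\: U)%MS.
have dC : (d <= \rank C)%N.
  have := mxrank_cap_compl W U; rewrite -/C => E.
  rewrite -(leq_add2r (\rank U)) (leq_trans dW) // -E addnC leq_add2l.
  by rewrite mxrankS ?capmxSr.
pose X := row_base C.
have XC : (X <= C)%MS by rewrite eq_row_base.
have : row_free (X *m cokermx U).
  apply: inj_row_free => v; rewrite mulmxA => /eqP; rewrite -submxE => vU.
  have : (v *m X <= C :&: U)%MS by rewrite sub_capmx vU mulmx_sub.
  rewrite capmx_diff submx0 mulmx_free_eq0 ?row_base_free //.
  by move/eqP.
have := mulmx_coker U; move: (cokermx U) => K UK /row_freeP[B XB].
exists (fun i => row (widen_ord dC i) X), (fun k => K *m col (widen_ord dC k) B).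
split=> [i|k|i k].
- by rewrite (submx_trans (row_sub _ _)) // (submx_trans XC) // diffmxSl.
- by rewrite mulmxA UK mul0mx.
- rewrite mulmxA -row_mul colE mulmxA -row_mul -colE XB.
  by apply/rowP => l; rewrite !ord1 !mxE eqxx mulr1n.
Qed.

Section Powers.
Variables (F : fieldType) (n : nat).
Implicit Types (S T : 'M[F]_n -> Prop) (f g : 'M[F]_n -> 'M[F]_n).

(* Indices are shifted: [power S j] is the set of products of [j + 1] factors. *)
Fixpoint power S (j : nat) (a : 'M[F]_n) : Prop :=
  if j is k.+1 then exists b c, [/\ power S k b, S c & a = b *m c] else S a.

(** Only products and [0] occur, so isomorphisms preserve this property; the largest possible [d]
    will measure a dimension. *)
Definition biorthogonal S (j d : nat) : Prop :=
  exists a b : 'I_d -> 'M[F]_n,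
  [/\ forall i, power S j (a i), forall i, S (b i) &
      forall i k, (a i *m b k == 0) = (i != k)].

Lemma power_sub S j a : (forall a b, S a -> S b -> S (a *m b)) ->
  power S j a -> S a.
Proof.
move=> Smul; elim: j a => //= j IHj _ [b [c [/IHj Sb Sc ->]]].
exact: Smul.
Qed.

End Powers.

Section Flag.
Variables (F : fieldType) (n r : nat) (V : nat -> 'M[F]_n).
Hypothesis flagV : is_flag r V.
Hypothesis r_gt1 : (1 < r)%N.
Local Notation S := (phi r V).

Lemma phi_le a : S a -> (a <= V r.-1)%MS.
Proof.
move=> Sa; rewrite -[a in (a <= _)%MS]mul1mx.
have r0 : (r.-1 < r)%N by rewrite prednK // ltnW.
apply: submx_trans (Sa r.-1 r0); rewrite prednK ?(ltnW r_gt1) //.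
exact/submxMr/(flag_full flagV).
Qed.

Lemma power_le j a : (j < r)%N -> power S j a -> (a <= V (r - j.+1))%MS.
Proof.
elim: j a => [|j IHj] a jr /=; first by rewrite subn1; exact: phi_le.
case=> b [c [/(IHj _ (ltnW jr)) bV Sc ->]]; apply: submx_trans (submxMr _ bV) _.
by have := Sc (r - j.+2)%N; rewrite subnSK //; apply; exact: leq_subr.
Qed.

Lemma top_functional : exists (f : 'cV[F]_n) (y : 'rV_n),
  V r.-1 *m f = 0 /\ y *m f = 1%:M.
Proof.
have r0 : (r.-1 < r)%N by rewrite prednK // ltnW.
have [y _ /sep_functional[f fP]] := flag_new flagV r0.
by exists f, y.
Qed.

Lemma bottom_vector : exists2 w : 'rV[F]_n, (w <= V 1)%MS & w != 0.
Proof.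
have [w wV Nw] := flag_new flagV (ltnW r_gt1); exists w => //.
by apply: contraNneq Nw => ->; rewrite sub0mx.
Qed.

Lemma phi_top_rank1 (f : 'cV_n) (v : 'rV_n) :
  V r.-1 *m f = 0 -> (v <= V r.-1)%MS -> S (f *m v).
Proof. by apply: phi_rank1 => //; apply: leq_pred. Qed.

(** The product is split through a vector [y] of the next larger flag member: if [g] kills the
    smaller one and [y *m g = 1], then [f *m v = (f *m y) *m (g *m v)]. *)
Lemma power_rank1 j (f : 'cV_n) (v : 'rV_n) : (j.+1 < r)%N ->
  V r.-1 *m f = 0 -> (v <= V (r - j.+1))%MS -> power S j (f *m v).
Proof.
move=> jr fV; elim: j jr v => [|j IHj] jr v vV /=.
  by rewrite subn1 in vV; apply: phi_top_rank1.
have lt_r : (r - j.+2 < r)%N by rewrite subnSK ?leq_subr // ltnW.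
have [y] := flag_new flagV lt_r; rewrite subnSK ?(ltnW jr) // => yV.
move=> /sep_functional[g [gV gy]].
exists (f *m y), (g *m v); split.
- by apply: IHj => //; apply: ltnW.
- by apply: phi_rank1 gV vV => //; apply: leq_subr.
- by rewrite mulmxA -(mulmxA f) gy mulmx1.
Qed.

(** Each [a i] has in its row space a vector killed by every [b k] except [b i]. These vectors are
    independent modulo [V 1] and lie in [V (r - j.+1)], which bounds [d]. Conversely, a dual family,
    with a fixed column [f] on one side and a fixed row [w] on the other, attains the bound. *)
Lemma biorthogonalP j d : (j.+1 < r)%N ->
  (biorthogonal S j d <-> d + \rank (V 1) <= \rank (V (r - j.+1)))%N.
Proof.
move=> jr; split=> [[a [b [Sa Sb ab]]]|].
  have /fin_all_exists[x xP] i : exists x : 'rV_n,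
      [/\ (x <= V (r - j.+1))%MS, x *m b i != 0 &
          forall k, i != k -> x *m b k = 0].
    have /rowV0Pn[_ /submxP[D ->] Dab] : a i *m b i != 0 by rewrite ab eqxx.
    exists (D *m a i); split.
    - by apply: mulmx_sub; apply: power_le (Sa i); apply: ltnW.
    - by rewrite -mulmxA.
    - by move=> k ik; rewrite -mulmxA; have := ab i k; rewrite ik => /eqP->; rewrite mulmx0.
  pose X := \matrix_i x i.
  (* Applying [b k] isolates the [k]-th coefficient, because [b k] kills [V 1]. *)
  have indep (c : 'rV_d) : (c *m X <= V 1)%MS -> c = 0.
    move=> cX; apply/rowP => k; rewrite mxE.
    have : c *m X *m b k = 0.
      apply/eqP; rewrite -submx0 -(flag0 flagV).
      exact: submx_trans (submxMr _ cX) (Sb k 0%N (ltnW r_gt1)).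
    rewrite (mulmx_sum_row c) mulmx_suml (bigD1 k) //= big1 => [|i ik].
      rewrite addr0 -scalemxAl rowK => /eqP; rewrite scaler_eq0.
      by have [_ /negPf-> _] := xP k; rewrite orbF => /eqP.
    by rewrite -scalemxAl rowK; have [_ _ -> //] := xP i; rewrite scaler0.
  have Xfree : row_free X.
    by apply: inj_row_free => c cX; apply: indep; rewrite cX sub0mx.
  have XV1 : (X :&: V 1 = 0)%MS.
    apply/eqP/rowV0P => v; rewrite sub_capmx => /andP[/submxP[c ->] /indep ->].
    by rewrite mul0mx.
  rewrite -(eqP Xfree) -(mxrank_disjoint_sum XV1) mxrankS // addsmx_sub.
  apply/andP; split; first by apply/row_subP => i; rewrite rowK; have [] := xP i.
  by rewrite (flag_le flagV) // subn_gt0 jr leq_subr.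
move=> /dual_family[x [g [xV gV xg]]].
have [f [y [fV fy]]] := top_functional; have [w wV w0] := bottom_vector.
exists (fun i => f *m x i), (fun k => g k *m w); split.
- by move=> i; apply: power_rank1.
- by move=> k; apply: phi_rank1 wV => //; apply: ltnW.
- move=> i k; rewrite mulmxA -(mulmxA f) xg mul_mx_scalar -scalemxAl scaler_eq0.
  have /negPf-> : f *m w != 0.
    by apply: contraNneq w0 => E; rewrite -[w]mul1mx -fy -mulmxA E mulmx0.
  by rewrite orbF; case: (i == k); rewrite /= ?mulr1n ?mulr0n ?oner_eq0 ?eqxx.
Qed.

End Flag.

(** * Annihilators and the dimension of the first subspace *)

Section Annihilators.
Variables (F : fieldType) (n : nat).
Implicit Types (S T : 'M[F]_n -> Prop) (f g : 'M[F]_n -> 'M[F]_n).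

Definition left_ann S a := S a /\ forall s, S s -> s *m a = 0.
Definition right_ann S b := S b /\ forall s, S s -> b *m s = 0.
(** A multiplicative preorder that will turn out to be inclusion of the images of [V r.-1]. *)
Definition dominated S (b b' : 'M[F]_n) :=
  forall a, left_ann S a -> exists2 a', left_ann S a' & a *m b = a' *m b'.
(** A multiplicative substitute for the image of [V r.-1] under [b] having dimension at most one: a
    subspace of larger dimension contains two incomparable lines. *)
Definition chain_below S b := forall c c', right_ann S c -> right_ann S c' ->
  dominated S c b -> dominated S c' b -> dominated S c c' \/ dominated S c' c.

Section Transport.
Variables (S T : 'M[F]_n -> Prop) (f g : 'M[F]_n -> 'M[F]_n).
Hypothesis fg : mutually_inverse_iso S T f g.
Hypotheses (S0 : S 0) (T0 : T 0).

Lemma iso0 : f 0 = 0.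
Proof.
have [[fT gf fM] [gS fgK gM]] := fg.
have Sg0 := gS _ T0.
by have := fM _ _ S0 Sg0; rewrite mul0mx fgK // mulmx0.
Qed.

Lemma iso_left_ann a : left_ann S a -> left_ann T (f a).
Proof.
have [[fT gf fM] [gS fgK gM]] := fg; move=> [Sa aS]; split; first exact: fT.
by move=> t Tt; rewrite -[t]fgK // -fM ?aS ?iso0 //; apply: gS.
Qed.

Lemma iso_right_ann a : right_ann S a -> right_ann T (f a).
Proof.
have [[fT gf fM] [gS fgK gM]] := fg; move=> [Sa aS]; split; first exact: fT.
by move=> t Tt; rewrite -[t]fgK // -fM ?aS ?iso0 //; apply: gS.
Qed.

End Transport.

Lemma iso_dominated S T f g b b' : mutually_inverse_iso S T f g ->
  S 0 -> T 0 -> S b -> S b' -> dominated S b b' -> dominated T (f b) (f b').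
Proof.
move=> fg S0 T0 Sb Sb' bb a Aa; have [[fT gf fM] [gS fgK gM]] := fg.
have Aga := iso_left_ann (mutually_inverse_isoC fg) T0 S0 Aa.
have [a' Aa' E] := bb _ Aga; exists (f a'); first exact: iso_left_ann fg _ _ _ Aa'.
have [[[Ta _] [Sga _]] [Sa' _]] := (Aa, Aga, Aa').
by rewrite -fM // -E fM // fgK.
Qed.

Lemma iso_chain_below S T f g b : mutually_inverse_iso S T f g ->
  S 0 -> T 0 -> S b -> chain_below S b -> chain_below T (f b).
Proof.
move=> fg S0 T0 Sb chb c c' Bc Bc' cb c'b.
have gf := mutually_inverse_isoC fg.
have [[fT gfK fM] [gS fgK gM]] := fg.
have gdom x y : T x -> T y -> dominated T x y -> dominated S (g x) (g y).
  exact: iso_dominated gf T0 S0.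
have fdom x y : T x -> T y -> dominated S (g x) (g y) -> dominated T x y.
  move=> Tx Ty; rewrite -{2}(fgK x) // -{2}(fgK y) //.
  by apply: iso_dominated fg _ _ _ _ => //; apply: gS.
have Bg x : right_ann T x -> right_ann S (g x) := iso_right_ann gf T0 S0 (a := x).
have [[Tc _] [Tc' _]] := (Bc, Bc').
have gb x : T x -> dominated T x (f b) -> dominated S (g x) b.
  by move=> Tx xb; rewrite -(gfK b) //; apply: gdom => //; apply: fT.
case: (chb _ _ (Bg _ Bc) (Bg _ Bc') (gb _ Tc cb) (gb _ Tc' c'b)) => H.
  by left; apply: fdom.
by right; apply: fdom.
Qed.

End Annihilators.

Section Flag.
Variables (F : fieldType) (n r : nat) (V : nat -> 'M[F]_n).
Hypothesis flagV : is_flag r V.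
Hypothesis r_gt1 : (1 < r)%N.
Local Notation S := (phi r V).

(** The elements [f *m x], with [f] a functional killing [V r.-1], test the rows [x] of [V r.-1] one
    at a time. *)
Lemma left_annP a : left_ann S a <-> S a /\ V r.-1 *m a = 0.
Proof.
split=> [[Sa aS]|[Sa Va]]; split=> //; last first.
  by move=> s Ss; have /submxP[D ->] := phi_le flagV r_gt1 Ss; rewrite -mulmxA Va mulmx0.
have [f [y [fV fy]]] := top_functional flagV r_gt1.
apply/row_matrixP => i; rewrite row_mul row0 -[_ *m a]mul1mx -fy -mulmxA.
by rewrite (mulmxA f) aS ?mulmx0 //; apply: phi_top_rank1 => //; apply: row_sub.
Qed.

(** A row of [b] outside [V 1] would be detected by some [g *m w] with [g] vanishing on [V 1] and
    [w] in [V 1]. *)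
Lemma right_annP b : right_ann S b <-> S b /\ (b <= V 1)%MS.
Proof.
split=> [[Sb bS]|[Sb bV]]; split=> //; last first.
  move=> s Ss; have /submxP[D ->] := bV; apply/eqP; rewrite -mulmxA -submx0 -(flag0 flagV).
  exact: mulmx_sub (Ss 0%N (ltnW r_gt1)).
apply/row_subP => i; apply: contrapT => /negP/sep_functional[g [gV gi]].
have [w wV w0] := bottom_vector flagV r_gt1.
move/eqP: w0; apply; rewrite -[w]mul1mx -gi rowE -!mulmxA bS ?mulmx0 //.
by apply: phi_rank1 gV wV => //; apply: ltnW.
Qed.

Lemma dominatedP b b' : dominated S b b' <-> (V r.-1 *m b <= V r.-1 *m b')%MS.
Proof.
split=> [bb|/submxP[D DE]].
  have [f [y [fV fy]]] := top_functional flagV r_gt1.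
  apply/row_subP => i; rewrite row_mul; set x := row i _.
  have xV : (x <= V r.-1)%MS by apply: row_sub.
  have [|a' [Sa' _] E] := bb (f *m x).
    by apply/left_annP; split; [apply: phi_top_rank1 | rewrite mulmxA fV mul0mx].
  rewrite -[x]mul1mx -fy -!mulmxA (mulmxA f) E !mulmxA submxMr //.
  by apply: mulmx_sub; apply: phi_le.
move=> a /left_annP[Sa Va].
have /submxP[C CE] := phi_le flagV r_gt1 Sa.
(* [E] kills [V r.-1] and fixes [a]; multiplying by it on the left forces the new factor into
   [left_ann] without changing the product. *)
pose E := 1%:M - pinvmx (V r.-1) *m V r.-1.
have VE : V r.-1 *m E = 0.
  by rewrite mulmxBr mulmx1 mulmxA mulmxKpV ?subrr.
have Ea : E *m a = a by rewrite mulmxBl mul1mx -mulmxA Va mulmx0 subr0.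
exists (E *m (C *m D *m V r.-1)); last first.
  by rewrite -!mulmxA -DE (mulmxA C) -CE mulmxA Ea.
apply/left_annP; rewrite !mulmxA VE !mul0mx; split=> // i ir.
have [ir1|ir1] := ltnP i.+1 r.
  have /submxP[K ->] : (V i.+1 <= V r.-1)%MS.
    by apply: (flag_le flagV); rewrite leq_pred andbT -ltnS prednK // ltnW.
  by rewrite !mulmxA -(mulmxA K) VE mulmx0 !mul0mx sub0mx.
have -> : i = r.-1 by apply/eqP; rewrite -eqSS prednK ?(ltnW r_gt1) // eqn_leq ir.
by rewrite !mulmxA submxMl.
Qed.

Hypothesis wide : (2 + \rank (V 1) <= \rank (V r.-1))%N.

(** Since [V r.-1 / V 1] has dimension at least two, two functionals vanishing on [V 1] can be
    prescribed independently on it, and they carry the coefficients of [x] and [y]. *)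
Lemma realize (x y : 'rV_n) : (x <= V 1)%MS -> (y <= V 1)%MS ->
  exists2 b, right_ann S b & (V r.-1 *m b :=: x + y)%MS.
Proof.
move=> xV yV; have [u [g [uV gV ug]]] := dual_family wide.
pose i0 : 'I_2 := ord0; pose i1 : 'I_2 := ord_max.
have Sg i (z : 'rV_n) : (z <= V 1)%MS -> S (g i *m z).
  by move=> zV; apply: phi_rank1 zV => //; apply: ltnW.
exists (g i0 *m x + g i1 *m y).
  apply/right_annP; split; first by apply: phi_add; apply: Sg.
  by rewrite addmx_sub // mulmx_sub.
apply/eqmxP; rewrite mulmxDr addmx_sub_adds ?mulmxA ?submxMl //= addsmx_sub.
have ub i (z : 'rV_n) : u i *m (g i0 *m x + g i1 *m y) = z ->
    (z <= (V r.-1 *m g i0 *m x + V r.-1 *m g i1 *m y)%R)%MS.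
  by move=> <-; rewrite -!mulmxA -mulmxDr submxMr.
apply/andP; split; [apply: (ub i0) | apply: (ub i1)].
  by rewrite mulmxDr !mulmxA !ug mulr1n mulr0n mul1mx mul_scalar_mx scale0r addr0.
by rewrite mulmxDr !mulmxA !ug mulr1n mulr0n mul1mx mul_scalar_mx scale0r add0r.
Qed.

Lemma realize1 (x : 'rV_n) : (x <= V 1)%MS ->
  exists2 b, right_ann S b & (V r.-1 *m b :=: x)%MS.
Proof.
move=> xV; have [b Bb bx] := realize xV xV; exists b => //.
by apply: eqmx_trans bx _; apply/addsmx_idPl.
Qed.

Lemma chain_belowP b :
  right_ann S b -> (chain_below S b <-> \rank (V r.-1 *m b) <= 1)%N.
Proof.
move=> /right_annP[Sb bV]; split=> [chb|rb c c' _ _ /dominatedP cb /dominatedP c'b].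
  rewrite leqNgt; apply/negP => /rank_gt1[x [y [xb yb xy]]].
  have [|c Bc cx] := @realize1 x; first exact: submx_trans xb (mulmx_sub _ bV).
  have [|c' Bc' cy] := @realize1 y; first exact: submx_trans yb (mulmx_sub _ bV).
  have := chb _ _ Bc Bc'; rewrite !dominatedP !cx !cy => /(_ xb yb)[] /sub_rVP[t E].
    have [] := xy 1 (- t); first by rewrite scale1r E scaleNr subrr.
    by move/eqP; rewrite oner_eq0.
  have [] := xy (- t) 1; first by rewrite scale1r E scaleNr addNr.
  by move=> _ /eqP; rewrite oner_eq0.
rewrite !dominatedP; have [c0|c1] := posnP (\rank (V r.-1 *m c)).
  by left; move/eqP: c0; rewrite mxrank_eq0 => /eqP->; rewrite sub0mx.
right; apply: submx_trans c'b _.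
have := mxrank_leqif_sup cb => /leqifP; case: ifP => // _ lt.
by have := leq_trans lt rb; rewrite ltnNge c1.
Qed.

End Flag.

(** * Recovering the dimension of [V 1] in the wide case *)

Section Invariance.
Variables (F : fieldType) (n r : nat) (V V' : nat -> 'M[F]_n).
Hypotheses (flagV : is_flag r V) (flagV' : is_flag r V') (r_gt1 : (1 < r)%N).
Hypotheses (wide : (2 + \rank (V 1) <= \rank (V r.-1))%N)
           (wide' : (2 + \rank (V' 1) <= \rank (V' r.-1))%N).
Local Notation S := (phi r V).
Local Notation T := (phi r V').

(* Join-compatibility of the bijection between points of the projective spaces
   of [V' 1] and [V 1]: preimages of a basis of [V' 1] must span [V 1]. *)
Lemma iso_rank1_le f g : mutually_inverse_iso S T f g ->
  (\rank (V 1) <= \rank (V' 1))%N.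
Proof.
move=> fg; have gf := mutually_inverse_isoC fg.
have S0 : S 0 by apply: phi0.
have T0 : T 0 by apply: phi0.
have [[fT gfK fM] [gS fgK gM]] := fg.
have fB b : right_ann S b -> right_ann T (f b) := iso_right_ann fg S0 T0 (a := b).
have gB b : right_ann T b -> right_ann S (g b) := iso_right_ann gf T0 S0 (a := b).
have g_le c c' : right_ann T c -> right_ann T c' ->
    (V' r.-1 *m c <= V' r.-1 *m c')%MS -> (V r.-1 *m g c <= V r.-1 *m g c')%MS.
  move=> [Tc _] [Tc' _] /(dominatedP flagV' r_gt1)/(iso_dominated gf T0 S0 Tc Tc').
  by move/(dominatedP flagV r_gt1).
have f_le b b' : right_ann S b -> right_ann S b' ->
    (V r.-1 *m b <= V r.-1 *m b')%MS -> (V' r.-1 *m f b <= V' r.-1 *m f b')%MS.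
  move=> [Sb _] [Sb' _] /(dominatedP flagV r_gt1)/(iso_dominated fg S0 T0 Sb Sb').
  by move/(dominatedP flagV' r_gt1).
have g1 c : right_ann T c -> (\rank (V' r.-1 *m c) <= 1)%N -> (\rank (V r.-1 *m g c) <= 1)%N.
  move=> Bc /(chain_belowP flagV' r_gt1 wide' Bc).
  move/(iso_chain_below gf T0 S0 Bc.1)/(chain_belowP flagV r_gt1 wide); apply; exact: gB.
have f1 b : right_ann S b -> (\rank (V r.-1 *m b) <= 1)%N -> (\rank (V' r.-1 *m f b) <= 1)%N.
  move=> Bb /(chain_belowP flagV r_gt1 wide Bb).
  move/(iso_chain_below fg S0 T0 Bb.1)/(chain_belowP flagV' r_gt1 wide'); apply; exact: fB.
have line m (A : 'M[F]_(m, n)) : (\rank A <= 1)%N -> exists x : 'rV_n, (A :=: x)%MS.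
  move=> A1; exists (nz_row A); apply/eqmxP/andP; split; last exact: nz_row_sub.
  rewrite -(mxrank_leqif_sup (nz_row_sub A)).2 rank_rV nz_row_eq0 -mxrank_eq0.
  by case: (\rank A) A1 => [|[]].
have rk1 (A : 'M[F]_n) (x : 'rV_n) : (A :=: x)%MS -> (\rank A <= 1)%N.
  by move->; rewrite rank_leq_row.
have in1 b : right_ann S b -> (V r.-1 *m b <= V 1)%MS.
  by move=> /(right_annP flagV r_gt1)[_ bV]; apply: mulmx_sub.
have in1' b : right_ann T b -> (V' r.-1 *m b <= V' 1)%MS.
  by move=> /(right_annP flagV' r_gt1)[_ bV]; apply: mulmx_sub.
pose Y := row_base (V' 1); have YV : (Y :=: V' 1)%MS by apply: eq_row_base.
have /fin_all_exists2[c cB cY] i : exists2 c, right_ann T c & (V' r.-1 *m c :=: row i Y)%MS.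
  by apply: (realize1 flagV' r_gt1 wide'); rewrite -YV row_sub.
pose U := (\sum_i <<V r.-1 *m g (c i)>>)%MS.
have rankU : (\rank U <= \rank (V' 1))%N.
  rewrite -[X in (_ <= X)%N]card_ord -sum1_card.
  apply: leq_trans (mxrank_sum_leqif _).1 _ => /=; apply: leq_sum => i _.
  by rewrite mxrank_gen g1 // cY rank_leq_row.
apply: leq_trans rankU; apply: mxrankS.
(* [Q v] says that whatever lies under the point [v] is carried by [g] into [U]. It is clear for
   multiples of basis rows; the issue is to pass to sums. *)
pose Q (v : 'rV_n) := (v <= V' 1)%MS /\ forall d, right_ann T d ->
  (V' r.-1 *m d <= v)%MS -> (V r.-1 *m g d <= U)%MS.
have Q0 : Q 0.
  split=> [|d Bd d0]; first exact: sub0mx.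
  have B0 : right_ann T 0 by split=> // s _; rewrite mul0mx.
  have := g_le _ _ Bd B0; rewrite mulmx0 (iso0 gf T0 S0) mulmx0 => /(_ _)/submx_trans; apply.
    by apply: submx_trans d0 (sub0mx _ _).
  exact: sub0mx.
have QZ t i : Q (t *: row i Y).
  split=> [|d Bd dv]; first by rewrite scalemx_sub // -YV row_sub.
  rewrite (sumsmx_sup i) // genmxE; apply: g_le => //.
  by rewrite cY (submx_trans dv) // scalemx_sub.
have QD v w : Q v -> Q w -> Q (v + w).
  move=> [vV Qv] [wV Qw]; split=> [|d Bd dvw]; first exact: addmx_sub.
  have [dv Bv Ev] := realize1 flagV' r_gt1 wide' vV.
  have [dw Bw Ew] := realize1 flagV' r_gt1 wide' wV.
  have [x Ex] := line _ _ (g1 _ Bv (rk1 _ _ Ev)).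
  have [y Ey] := line _ _ (g1 _ Bw (rk1 _ _ Ew)).
  (* [b] realises the span of the points corresponding to [v] and [w]. Then [f b] lies above both,
     hence above [v + w] and [d], so [g d] lies under [b]. *)
  have [||b Bb Eb] := realize flagV r_gt1 wide (x := x) (y := y).
  - by rewrite -Ex in1 //; apply: gB.
  - by rewrite -Ey in1 //; apply: gB.
  have bU : (V r.-1 *m b <= U)%MS.
    by rewrite Eb addsmx_sub -Ex -Ey Qv ?Qw // ?Ev ?Ew.
  apply: submx_trans bU; rewrite -[b]gfK ?Bb.1 //; last by case: Bb.
  apply: g_le => //; first exact: fB.
  rewrite (submx_trans dvw) // addmx_sub // -1?Ev -1?Ew.
    rewrite -(fgK dv) ?Bv.1 //; last by case: Bv.
    by apply: f_le => //; [exact: gB | rewrite Ex Eb addsmxSl].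
  rewrite -(fgK dw); last by case: Bw.
  by apply: f_le => //; [exact: gB | rewrite Ey Eb addsmxSr].
have QV (v : 'rV_n) : (v <= V' 1)%MS -> Q v.
  rewrite -YV => /submxP[D ->]; rewrite mulmx_sum_row.
  by apply: (big_ind Q) => // i _; apply: QZ.
(* The point of each row of [V 1] goes through [f] to some [x] in [V' 1], and [Q x] brings it back
   inside [U]. *)
apply/row_subP => i; have [b Bb Eb] := realize1 flagV r_gt1 wide (row_sub i (V 1)).
have [|x Ex] := line _ _ (f1 _ Bb _); first by rewrite Eb rank_leq_row.
rewrite -Eb -(gfK b); last by case: Bb.
by have [|_] := QV x; [rewrite -Ex in1' //; apply: fB | apply; [apply: fB | rewrite Ex]].
Qed.

End Invariance.

(** * Flags of signature (k, 1, l) *)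

Section RankOne.
Variable F : fieldType.

Lemma row_left_inverse n (w : 'rV[F]_n) : w != 0 -> exists z : 'cV_n, w *m z = 1%:M.
Proof.
move=> w0; have [|z [_ wz]] := @sep_functional F n n 0 w; last by exists z.
by rewrite submx0.
Qed.

Lemma col_right_inverse n (v : 'cV[F]_n) : v != 0 -> exists y : 'rV_n, y *m v = 1%:M.
Proof.
rewrite -trmx_eq0 => /row_left_inverse[z vz]; exists z^T.
by rewrite -[v]trmxK -trmx_mul vz trmx1.
Qed.

Lemma rank1_eq0 m n (v : 'cV[F]_m) (w : 'rV[F]_n) : (v *m w == 0) = (v == 0) || (w == 0).
Proof.
apply/eqP/orP => [vw|[/eqP->|/eqP->]]; rewrite ?mul0mx ?mulmx0 //.
have [|/col_right_inverse[y yv]] := eqVneq v 0; first by left.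
by right; rewrite -[w]mul1mx -yv -mulmxA vw mulmx0.
Qed.

Lemma rank1_eq m n (v v' : 'cV[F]_m) (w w' : 'rV[F]_n) :
  v *m w = v' *m w' -> v *m w != 0 -> exists t, v = t *: v' /\ w' = t *: w.
Proof.
move=> E vw0; have vw0' := vw0; rewrite E rank1_eq0 negb_or in vw0'.
have /andP[/col_right_inverse[y yv'] _] := vw0'.
rewrite rank1_eq0 negb_or in vw0; have /andP[_ /row_left_inverse[z wz]] := vw0.
pose t := (y *m v) 0 0.
have w't : w' = t *: w.
  by rewrite -[w']mul1mx -yv' -mulmxA -E mulmxA [y *m v]mx11_scalar mul_scalar_mx.
exists t; split=> //; rewrite -[v]mulmx1 -wz mulmxA E w't -scalemxAr.
by rewrite -scalemxAl -mulmxA wz mulmx1.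
Qed.

End RankOne.

(** * Coordinates when [V 2 / V 1] is a line *)

Section Thin.
Variables (F : fieldType) (n : nat) (V : nat -> 'M[F]_n).
Local Notation S := (phi 3 V).

(** [u] and [chi] are dual generators of the line [V 2 / V 1], and the last clause says that
    products factor through this line. *)
Definition thin (u : 'rV[F]_n) (chi : 'cV[F]_n) : Prop :=
  [/\ (u <= V 2)%MS, V 1 *m chi = 0, u *m chi = 1%:M &
      forall a b, S a -> S b -> a *m b = (a *m chi) *m (u *m b)].

Hypothesis flagV : is_flag 3 V.

(** [a] takes values in [V 2], which is [V 1 + u], and [b] kills [V 1]; only the [u]-component of
    [a], read by [chi], survives. *)
Lemma thin_exists : \rank (V 2) = (\rank (V 1)).+1 -> exists u chi, thin u chi.
Proof.
move=> r2; have [u uV Nu] := flag_new flagV (isT : (1 < 3)%N).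
have [chi [Vchi uchi]] := sep_functional Nu.
exists u, chi; split=> // a b Sa Sb.
have V2 : (V 2 <= V 1 + u)%MS.
  have le : (V 1 + u <= V 2)%MS by rewrite addsmx_sub uV ltmxW // (flag_ltS flagV).
  rewrite -(mxrank_leqif_sup le).2 eqn_leq mxrankS //= r2.
  by apply: rank_ltmx; rewrite ltmxE addsmxSl addsmx_sub submx_refl.
have /sub_addsmxP[[c d] /= ->] : (a <= V 1 + u)%MS.
  by apply: submx_trans V2; apply: (phi_le flagV) Sa.
have -> : (c *m V 1 + d *m u) *m chi = d.
  by rewrite mulmxDl -!mulmxA Vchi uchi mulmx0 add0r mulmx1.
have Vb : V 1 *m b = 0 by apply/eqP; rewrite -submx0 -(flag0 flagV); apply: Sb.
by rewrite mulmxDl -mulmxA Vb mulmx0 add0r mulmxA.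
Qed.

(** Functionals vanishing on [V 2], transposed into rows so that row space calculus applies to
    them. *)
Definition top_dual : 'M[F]_n := kermx (V 2)^T.

Lemma top_dualP (v : 'cV_n) : (v^T <= top_dual)%MS <-> V 2 *m v = 0.
Proof.
rewrite /top_dual; split=> [/sub_kermxP|E].
  by rewrite -trmx_mul => /(congr1 trmx); rewrite trmxK trmx0.
by apply/sub_kermxP; rewrite -trmx_mul E trmx0.
Qed.

Lemma rank_top_dual : \rank top_dual = (n - \rank (V 2))%N.
Proof. by rewrite mxrank_ker mxrank_tr. Qed.

Section Coordinates.
Variables (u : 'rV[F]_n) (chi : 'cV[F]_n).
Hypothesis uchiP : thin u chi.

Lemma thin_mul a b : S a -> S b -> a *m b = (a *m chi) *m (u *m b).
Proof. by move: a b; have [] := uchiP. Qed.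

Lemma thin_col a : S a -> V 2 *m (a *m chi) = 0.
Proof.
move=> Sa; have [_ Vchi _ _] := uchiP.
have /submxP[D E] := Sa 1%N isT.
by rewrite mulmxA E -mulmxA Vchi mulmx0.
Qed.

Lemma thin_row a : S a -> (u *m a <= V 1)%MS.
Proof.
move=> Sa; have [uV _ _ _] := uchiP.
by apply: submx_trans (submxMr _ uV) _; apply: Sa.
Qed.

Lemma thin_rank1 (v : 'cV_n) (w : 'rV_n) : V 2 *m v = 0 -> (w <= V 1)%MS ->
  [/\ S (v *m w), v *m w *m chi = 0 & u *m (v *m w) = 0].
Proof.
move=> Vv wV; have [uV Vchi uchi _] := uchiP; split.
- apply: (phi_rank1 flagV (i := 2)) => //; apply: submx_trans wV _.
  exact: (flag_le flagV).
- by have /submxP[D ->] := wV; rewrite -!mulmxA Vchi !mulmx0.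
- by have /submxP[D ->] := uV; rewrite mulmxA -(mulmxA D) Vv mulmx0 mul0mx.
Qed.

(** The two coordinates [a *m chi] and [u *m a] can be prescribed independently. *)
Lemma thin_section (v : 'cV_n) (w : 'rV_n) : V 2 *m v = 0 -> (w <= V 1)%MS ->
  [/\ S (v *m u + chi *m w), (v *m u + chi *m w) *m chi = v &
      u *m (v *m u + chi *m w) = w].
Proof.
move=> Vv wV; have [uV Vchi uchi _] := uchiP.
have uv : u *m v = 0 by have /submxP[D ->] := uV; rewrite -mulmxA Vv mulmx0.
have wchi : w *m chi = 0 by have /submxP[D ->] := wV; rewrite -mulmxA Vchi mulmx0.
split.
- by apply: phi_add; [apply: (phi_rank1 flagV (i := 2)) | apply: (phi_rank1 flagV (i := 1))].
- by rewrite mulmxDl -!mulmxA uchi wchi mulmx0 addr0 mulmx1.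
- by rewrite mulmxDr !mulmxA uv uchi mul0mx add0r mul1mx.
Qed.

Lemma thin_factor (v : 'cV_n) (w : 'rV_n) : V 2 *m v = 0 -> (w <= V 1)%MS ->
  exists a b, [/\ S a, S b, a *m chi = v, u *m b = w & a *m b = v *m w].
Proof.
move=> Vv wV.
have [Sa av _] := thin_section Vv (sub0mx _ _ : ((0 : 'rV_n) <= V 1)%MS).
have [Sb _ bw] := thin_section (mulmx0 _ _ : V 2 *m (0 : 'cV_n) = 0) wV.
by do 2!eexists; split; [exact: Sa|exact: Sb|exact: av|exact: bw|rewrite thin_mul // av bw].
Qed.

End Coordinates.

End Thin.

(** * Multiplicative tests for [d_1 = 1] and [d_3 = 1] *)

Section ThinInvariants.
Variables (F : fieldType) (n : nat).
Implicit Types (S T : 'M[F]_n -> Prop) (f g : 'M[F]_n -> 'M[F]_n).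

(** For thin flags this says that the nonzero rows [u *m b] are all proportional; [left_line] says
    the same of the columns [a *m chi]. *)
Definition right_line S := forall a b b', S a -> S b -> S b' ->
  a *m b != 0 -> a *m b' != 0 -> exists2 a', S a' & a' *m b = a *m b'.
Definition left_line S := forall a a' b, S a -> S a' -> S b ->
  a *m b != 0 -> a' *m b != 0 -> exists2 b', S b' & a *m b' = a' *m b.

Lemma iso_neq0 S T f g a : mutually_inverse_iso S T f g -> S 0 -> T 0 ->
  S a -> a != 0 -> f a != 0.
Proof.
move=> fg S0 T0 Sa; have [[fT gfK fM] _] := fg.
by apply: contraNneq => fa0; rewrite -(gfK a) // fa0 (iso0 (mutually_inverse_isoC fg) T0 S0).
Qed.

Lemma iso_right_line S T f g : mutually_inverse_iso S T f g -> S 0 -> T 0 ->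
  (forall c d, T c -> T d -> T (c *m d)) -> right_line S -> right_line T.
Proof.
move=> fg S0 T0 TM SR a b b' Ta Tb Tb' ab ab'.
have gf := mutually_inverse_isoC fg; have [[fT gfK fM] [gS fgK gM]] := fg.
have [||a' Sa' E] := SR _ _ _ (gS a Ta) (gS b Tb) (gS b' Tb').
- by rewrite -gM //; apply: iso_neq0 gf _ _ (TM _ _ _ _) _.
- by rewrite -gM //; apply: iso_neq0 gf _ _ (TM _ _ _ _) _.
exists (f a'); first exact: fT.
by rewrite -{1}(fgK b) // -fM ?E -?gM ?fgK //; [apply: TM | apply: gS].
Qed.

Lemma iso_left_line S T f g : mutually_inverse_iso S T f g -> S 0 -> T 0 ->
  (forall c d, T c -> T d -> T (c *m d)) -> left_line S -> left_line T.
Proof.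
move=> fg S0 T0 TM SL a a' b Ta Ta' Tb ab ab'.
have gf := mutually_inverse_isoC fg; have [[fT gfK fM] [gS fgK gM]] := fg.
have [||b' Sb' E] := SL _ _ _ (gS a Ta) (gS a' Ta') (gS b Tb).
- by rewrite -gM //; apply: iso_neq0 gf _ _ (TM _ _ _ _) _.
- by rewrite -gM //; apply: iso_neq0 gf _ _ (TM _ _ _ _) _.
exists (f b'); first exact: fT.
by rewrite -{1}(fgK a) // -fM ?E -?gM ?fgK //; [apply: TM | apply: gS].
Qed.

End ThinInvariants.

Lemma submx_rank1 (F : fieldType) m n (U : 'M[F]_(m, n)) (x y : 'rV_n) :
  (\rank U <= 1)%N -> (x <= U)%MS -> (y <= U)%MS -> x != 0 ->
  exists t, y = t *: x.
Proof.
move=> U1 xU yU x0; apply/sub_rVP; apply: submx_trans yU _.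
by rewrite -(mxrank_leqif_sup xU).2 eqn_leq mxrankS //= rank_rV x0.
Qed.

Section ThinFlag.
Variables (F : fieldType) (n : nat) (V : nat -> 'M[F]_n).
Hypothesis flagV : is_flag 3 V.
Hypothesis thinV : \rank (V 2) = (\rank (V 1)).+1.
Local Notation S := (phi 3 V).

Lemma top_nz : exists2 v : 'cV[F]_n, V 2 *m v = 0 & v != 0.
Proof.
have [v [y [Vv yv]]] := top_functional flagV (isT : 1 < 3)%N; exists v => //.
apply: contra_eq_neq yv => ->; rewrite mulmx0 eq_sym -mxrank_eq0.
by rewrite mxrank1.
Qed.

(** With independent [x], [y] in [V 1] and [v] nonzero, [v *m y] is never of the form [v' *m x]. If
    the rows form a line, the scalar relating [u *m b] to [u *m b'] is absorbed into [a]. *)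
Lemma right_lineP : right_line S <-> (\rank (V 1) <= 1)%N.
Proof.
have [u [chi uchi]] := thin_exists flagV thinV; split=> [SR|V1 a b b' Sa Sb Sb'].
  rewrite leqNgt; apply/negP => /rank_gt1[x [y [xV yV xy]]].
  have [v Vv v0] := top_nz.
  have [a [b [Sa Sb av bx abE]]] := thin_factor flagV uchi Vv xV.
  have [a1 [b' [_ Sb' _ b'y _]]] := thin_factor flagV uchi Vv yV.
  have ab'E : a *m b' = v *m y by rewrite (thin_mul uchi) // av b'y.
  have x0 : x != 0.
    apply/eqP => x0; have [] := xy 1 0; rewrite ?x0 ?scaler0 ?scale0r ?addr0 //.
    by move/eqP; rewrite oner_eq0.
  have y0 : y != 0.
    apply/eqP => y0; have [] := xy 0 1; rewrite ?y0 ?scaler0 ?scale0r ?addr0 //.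
    by move=> _ /eqP; rewrite oner_eq0.
  have ab0 : a *m b != 0 by rewrite abE rank1_eq0 negb_or v0.
  have ab0' : a *m b' != 0 by rewrite ab'E rank1_eq0 negb_or v0.
  have [a' Sa'] := SR _ _ _ Sa Sb Sb' ab0 ab0'; rewrite ab'E.
  rewrite (thin_mul uchi) // bx; have [z zv] := col_right_inverse v0.
  move=> /(congr1 (mulmx z)); rewrite !mulmxA zv mul1mx.
  rewrite [_ *m chi]mx11_scalar mul_scalar_mx => E.
  have [|_ /eqP] := xy (- (z *m a' *m chi) 0 0) 1; last by rewrite oner_eq0.
  by rewrite scaleNr E scale1r addNr.
rewrite !(thin_mul uchi) // !rank1_eq0 !negb_or => /andP[_ qb] _.
have [t tE] := submx_rank1 V1 (thin_row uchi Sb) (thin_row uchi Sb') qb.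
exists (t *: a); first exact: phi_scale.
by rewrite tE -scalemxAl (thin_mul uchi) // scalemxAr.
Qed.

Lemma left_lineP : left_line S <-> (n - \rank (V 2) <= 1)%N.
Proof.
have [u [chi uchi]] := thin_exists flagV thinV; rewrite -rank_top_dual.
split=> [SL|V1 a a' b Sa Sa' Sb].
  rewrite leqNgt; apply/negP => /rank_gt1[x [y [xV yV xy]]].
  rewrite -[x]trmxK in xV; rewrite -[y]trmxK in yV.
  have [w wV w0] := bottom_vector flagV isT.
  move: xV yV => /top_dualP xV /top_dualP yV.
  have [a [b [Sa Sb ax bw abE]]] := thin_factor flagV uchi xV wV.
  have [a' [b1 [Sa' _ a'y _ _]]] := thin_factor flagV uchi yV wV.
  have a'bE : a' *m b = y^T *m w by rewrite (thin_mul uchi) // a'y bw.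
  have x0 : x != 0.
    apply/eqP => x0; have [] := xy 1 0; rewrite ?x0 ?scaler0 ?scale0r ?addr0 //.
    by move/eqP; rewrite oner_eq0.
  have y0 : y != 0.
    apply/eqP => y0; have [] := xy 0 1; rewrite ?y0 ?scaler0 ?scale0r ?addr0 //.
    by move=> _ /eqP; rewrite oner_eq0.
  have ab0 : a *m b != 0 by rewrite abE rank1_eq0 negb_or trmx_eq0 x0.
  have ab0' : a' *m b != 0 by rewrite a'bE rank1_eq0 negb_or trmx_eq0 y0.
  have [b' Sb'] := SL _ _ _ Sa Sa' Sb ab0 ab0'; rewrite a'bE.
  rewrite (thin_mul uchi) // ax; have [z wz] := row_left_inverse w0.
  move=> /(congr1 (mulmxr z)) /=; rewrite -!mulmxA wz mulmx1.
  rewrite [_ *m (_ *m z)]mx11_scalar mul_mx_scalar => /(congr1 trmx).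
  rewrite trmxK linearZ /= trmxK => E.
  have [|_ /eqP] := xy (- (u *m (b' *m z)) 0 0) 1; last by rewrite oner_eq0.
  by rewrite scaleNr E scale1r addNr.
rewrite !(thin_mul uchi) // !rank1_eq0 !negb_or => /andP[pa _] _.
rewrite -trmx_eq0 in pa.
have Ka c : S c -> ((c *m chi)^T <= top_dual V)%MS.
  by move=> Sc; apply/top_dualP; apply: (thin_col uchi).
have [t tE] := submx_rank1 V1 (Ka a Sa) (Ka a' Sa') pa.
exists (t *: b); first exact: phi_scale.
rewrite -scalemxAr (thin_mul uchi) // scalemxAl; congr (_ *m _).
by apply: trmx_inj; rewrite tE linearZ.
Qed.

End ThinFlag.

(** * Counting over finite fields *)

Lemma finite_rV_inj_leq (F : fieldType) d d' (h : 'rV[F]_d -> 'rV[F]_d') :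
  finite_field F -> injective h -> (d <= d')%N.
Proof.
move=> [s sP] hinj; pose e x : seq_sub s := SeqSub (sP x).
have ssvalK (v : seq_sub s) : e (ssval v) = v by apply: val_inj.
pose H (k : {ffun 'I_d -> seq_sub s}) : {ffun 'I_d' -> seq_sub s} :=
  [ffun i => e (h (\row_j ssval (k j)) 0 i)].
have Hinj : injective H.
  move=> k l /ffunP kl; have /hinj/rowP E : h (\row_j ssval (k j)) = h (\row_j ssval (l j)).
    by apply/rowP => i; have := kl i; rewrite !ffunE => -[].
  by apply/ffunP => j; have := E j; rewrite !mxE => /val_inj.
have := leq_card H Hinj; rewrite !card_ffun !card_ord leq_exp2l //.
(* The base of the powers is at least two because [0] and [1] differ, so exponents can be
   compared. *)
have : #|[set e 0; e 1]| = 2%N.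
  by rewrite cards2; case: eqP => // /(congr1 (@ssval _ _))/= /esym/eqP; rewrite oner_eq0.
by move=> <-; apply: max_card.
Qed.

(** Fix [b] with [u *m b] nonzero: the products [a *m b] separate the columns [a *m chi]. After
    transport by [f] they depend only on [f a *m chi'], which gives an injection between the two
    spaces of columns. *)
Lemma finite_iso_top_le (F : fieldType) n (V V' : nat -> 'M[F]_n) f g :
  finite_field F -> is_flag 3 V -> is_flag 3 V' ->
  (\rank (V 2) = (\rank (V 1)).+1)%N -> (\rank (V' 2) = (\rank (V' 1)).+1)%N ->
  mutually_inverse_iso (phi 3 V) (phi 3 V') f g ->
  (n - \rank (V 2) <= n - \rank (V' 2))%N.
Proof.
move=> Ffin fV fV' tV tV' fg.
have [u [chi uchi]] := thin_exists fV tV; have [u' [chi' uchi']] := thin_exists fV' tV'.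
have [[fT gfK fM] _] := fg.
have [w wV w0] := bottom_vector fV isT; have [z wz] := row_left_inverse w0.
have sec (v : 'cV_n) := thin_section fV uchi (v := v) (w := 0) ^~ (sub0mx _ _).
have [v0 Vv0 _] := top_nz fV.
have [_ [b [_ Sb _ bw _]]] := thin_factor fV uchi Vv0 wV.
rewrite -!rank_top_dual; pose K := row_base (top_dual V); pose K' := row_base (top_dual V').
have KV (x : 'rV_(\rank (top_dual V))) : V 2 *m (x *m K)^T = 0.
  by apply/top_dualP; rewrite trmxK (submx_trans (submxMl _ _)) // eq_row_base.
pose s (x : 'rV_(\rank (top_dual V))) := (x *m K)^T *m u + chi *m (0 : 'rV_n).
have Ss x : phi 3 V (s x) by have [] := sec _ (KV x).
have K'V x : ((f (s x) *m chi')^T <= K')%MS.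
  rewrite eq_row_base; apply/top_dualP.
  by apply: (thin_col uchi'); apply: fT.
apply: (@finite_rV_inj_leq F _ _ (fun x => (f (s x) *m chi')^T *m pinvmx K')) => // x y.
move/(congr1 (mulmx^~ K')); rewrite !mulmxKpV // => /trmx_inj E.
have : f (s x) *m f b = f (s y) *m f b.
  by rewrite !(thin_mul uchi') ?E //; apply: fT.
rewrite -!fM // => /(congr1 g); rewrite !gfK; try exact: phi_mul.
rewrite !(thin_mul uchi) // bw => /(congr1 (mulmx^~ z)).
have [_ -> _] := sec _ (KV x); have [_ -> _] := sec _ (KV y).
rewrite -!mulmxA wz !mulmx1 => /trmx_inj.
exact: (row_free_inj (row_base_free _)).
Qed.

(** * The exceptional isomorphisms *)

Section Fibers.
Variables (F : fieldType) (n : nat) (V : nat -> 'M[F]_n).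
Hypothesis flagV : is_flag 3 V.
Local Notation S := (phi 3 V).

(** In the thin case these are exactly the products of two elements of [S]. *)
Definition rank1_product (a : 'M[F]_n) : Prop :=
  exists (v : 'cV_n) (w : 'rV_n), [/\ V 2 *m v = 0, (w <= V 1)%MS & a = v *m w].

(** Elements that are not products and share both coordinates; they cannot be told apart by
    multiplication. *)
Definition fiber (u : 'rV_n) (chi : 'cV_n) (v : 'cV_n) (w : 'rV_n) : set 'M[F]_n :=
  [set a | [/\ S a, a *m chi = v, u *m a = w & ~ rank1_product a]]%classic.

(** To an element with the prescribed coordinates is added a family, indexed by [F], with zero
    coordinates. A [rank1_product] has zero coordinates, so it could only occur for [v = w = 0],
    where the rank of the added part excludes it. *)
Lemma fiber_inj u chi v w : thin V u chi ->
  (1 < \rank (V 1))%N -> (1 < n - \rank (V 2))%N ->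
  V 2 *m v = 0 -> (w <= V 1)%MS ->
  exists2 e : F -> 'M[F]_n, injective e & forall t, fiber u chi v w (e t).
Proof.
move=> uchi r1 r2 Vv wV.
have [|y [g [_ Vg yg]]] := @dual_family F n 2 (V 2) (V 3).
  by have [_ [/eqP-> _]] := flagV; rewrite addnC -leq_subRL // rank_leq_row.
have [|x [z [xV _ xz]]] := @dual_family F n 2 0 (V 1).
  by rewrite mxrank0 addn0.
have scalar1_inj (c d : F) : c%:M = d%:M :> 'M_1 -> c = d.
  by move/(congr1 (fun M : 'M_1 => M 0 0)); rewrite !mxE eqxx !mulr1n.
pose i0 : 'I_2 := ord0; pose i1 : 'I_2 := ord_max.
(* Tested on [y] and [z], this has the invertible matrix with rows [(1, t)] and [(0, 1)]. *)
pose core t := g i0 *m x i0 + g i1 *m x i1 + t *: (g i0 *m x i1).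
have coreP t : [/\ S (core t), core t *m chi = 0 & u *m core t = 0].
  have c i j : [/\ S (g i *m x j), g i *m x j *m chi = 0 & u *m (g i *m x j) = 0].
    exact: (thin_rank1 flagV uchi).
  have [S00 c00 u00] := c i0 i0; have [S11 c11 u11] := c i1 i1.
  have [S01 c01 u01] := c i0 i1; split.
  - by do 2?apply: phi_add => //; apply: phi_scale.
  - by rewrite !mulmxDl -scalemxAl c00 c11 c01 scaler0 !addr0.
  - by rewrite !mulmxDr -scalemxAr u00 u11 u01 scaler0 !addr0.
have ycz t i j : y i *m core t *m z j =
    ((i == j)%:R + t * ((i == i0) && (j == i1))%:R)%:M.
  have E i' j' : y i *m (g i' *m x j') *m z j = ((i == i') && (j == j'))%:R%:M.
    rewrite mulmxA yg mul_scalar_mx -scalemxAl xz scale_scalar_mx -natrM mulnb.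
    by rewrite (eq_sym j).
  rewrite !mulmxDr -scalemxAr !mulmxDl -scalemxAl !E scale_scalar_mx -!raddfD /=.
  by congr _%:M; case: i j {E} => [[|[|i]] ilt] // [[|[|j]] jlt].
have [Ss cs us] := thin_section flagV uchi Vv wV.
exists (fun t => (v *m u + chi *m w) + core t) => [t t' /addrI E|t].
  have := ycz t i0 i1; rewrite E ycz /= !mulr1 => /scalar1_inj /addrI.
  by [].
have [Sc cc uc] := coreP t; split.
- exact: phi_add.
- by rewrite mulmxDl cs cc addr0.
- by rewrite mulmxDr us uc addr0.
move=> [v0 [w0 [Vv0 w0V E]]].
have [_ c0 u0] := thin_rank1 flagV uchi Vv0 w0V.
have v_0 : v = 0 by rewrite -c0 -E mulmxDl cs cc addr0.
have w_0 : w = 0 by rewrite -u0 -E mulmxDr us uc addr0.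
have {}E : core t = v0 *m w0 by rewrite -E v_0 w_0 mul0mx mulmx0 !add0r.
have yz i j : (y i *m v0) 0 0 * (w0 *m z j) 0 0 =
    (i == j)%:R + t * ((i == i0) && (j == i1))%:R.
  apply: scalar1_inj; rewrite scalar_mxM -!mx11_scalar -ycz E.
  by rewrite !mulmxA.
(* The zero entry would make one factor vanish, against a diagonal entry equal to [1]. *)
have := yz i1 i0; rewrite /= mulr0 addr0 => /eqP; rewrite mulf_eq0 => /orP[]/eqP h.
  by have := yz i1 i1; rewrite h mul0r /= mulr0 addr0 => /esym/eqP; rewrite oner_eq0.
by have := yz i0 i0; rewrite h mulr0 /= mulr0 addr0 => /esym/eqP; rewrite oner_eq0.
Qed.

End Fibers.

Section ExceptionalIso.
Variables (F : fieldType) (n : nat) (V V' : nat -> 'M[F]_n).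
Hypothesis Finf : ~ finite_field F.
Hypotheses (flagV : is_flag 3 V) (flagV' : is_flag 3 V').
Hypotheses (thinV : \rank (V 2) = (\rank (V 1)).+1)
           (thinV' : \rank (V' 2) = (\rank (V' 1)).+1).
Hypotheses (bottom : (1 < \rank (V 1))%N) (bottom' : (1 < \rank (V' 1))%N).
Hypotheses (top : (1 < n - \rank (V 2))%N) (top' : (1 < n - \rank (V' 2))%N).
Local Notation S := (phi 3 V).
Local Notation T := (phi 3 V').

Lemma top_homogeneous_bij : exists k : 'cV[F]_n -> 'cV[F]_n,
  [/\ forall v, V 2 *m v = 0 -> V' 2 *m k v = 0,
      forall t v, k (t *: v) = t *: k v,
      forall v w, V 2 *m v = 0 -> V 2 *m w = 0 -> k v = k w -> v = w &
      forall w, V' 2 *m w = 0 -> exists2 v, V 2 *m v = 0 & k v = w].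
Proof.
have [||h [hV hZ hI hS]] := homogeneous_bij Finf (U := top_dual V) (U' := top_dual V').
- by rewrite rank_top_dual.
- by rewrite rank_top_dual.
exists (fun v => (h v^T)^T); split.
- by move=> v /top_dualP/hV; rewrite -{1}[h _]trmxK => /top_dualP.
- by move=> t v; rewrite linearZ /= hZ linearZ.
- by move=> v w /top_dualP Vv /top_dualP Vw /trmx_inj/hI E; apply: trmx_inj; apply: E.
- move=> w /top_dualP/hS[v vV hv]; exists v^T; last by rewrite trmxK hv trmxK.
  by apply/top_dualP; rewrite trmxK.
Qed.

(* Products only see the coordinates [a *m chi] and [u *m b], up to a common
   scalar; a homogeneous change of these coordinates determines the map on
   products, and on all other elements only cardinalities matter. *)
Lemma exceptional_iso : semigroup_iso S T.
Proof.
have [u [chi uchi]] := thin_exists flagV thinV.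
have [u' [chi' uchi']] := thin_exists flagV' thinV'.
have [k [kV kZ kI kS]] := top_homogeneous_bij.
have [h [hV hZ hI hS]] := homogeneous_bij Finf bottom bottom'.
have k0 : k 0 = 0 by have := kZ 0 0; rewrite !scale0r.
have h0 : h 0 = 0 by have := hZ 0 0; rewrite !scale0r.
(* A nonzero rank one matrix fixes its factors up to a scalar moved across, and homogeneous maps
   respect this. *)
have khP v v1 w w1 : V 2 *m v = 0 -> V 2 *m v1 = 0 -> (w <= V 1)%MS -> (w1 <= V 1)%MS ->
    v *m w = v1 *m w1 <-> k v *m h w = k v1 *m h w1.
  move=> Vv Vv1 wV w1V.
  have kh0 v2 w2 : V 2 *m v2 = 0 -> (w2 <= V 1)%MS -> (k v2 *m h w2 == 0) = (v2 *m w2 == 0).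
    move=> Vv2 w2V; rewrite !rank1_eq0; congr (_ || _); apply/eqP/eqP => [E|->//].
      by apply: kI => //; [rewrite mulmx0 | rewrite k0].
    by apply: hI => //; [exact: sub0mx | rewrite h0].
  have [z|nz] := eqVneq (v *m w) 0.
    have := kh0 _ _ Vv wV; rewrite z eqxx => /eqP ->.
    by split=> /esym/eqP; rewrite (kh0, =^~ kh0) // => /eqP.
  split=> [E|E].
    have [t [-> ->]] := rank1_eq E nz.
    by rewrite kZ hZ -scalemxAl scalemxAr.
  have [|t [kt ht]] := rank1_eq E; first by rewrite kh0.
  have -> : v = t *: v1 by apply: kI => //; rewrite ?kZ // -scalemxAr Vv1 scaler0.
  have -> : w1 = t *: w by apply: hI => //; rewrite ?hZ // scalemx_sub.
  by rewrite -scalemxAl scalemxAr.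
have /choice[e eP] a : exists c, forall v w, V 2 *m v = 0 -> (w <= V 1)%MS ->
    a = v *m w -> c = k v *m h w.
  have [[v [w [Vv wV ->]]]|Na] := lem (rank1_product V a).
    by exists (k v *m h w) => v1 w1 Vv1 w1V; apply: (khP _ _ _ _ Vv Vv1 wV w1V).1.
  by exists 0 => v w Vv wV aE; case: Na; exists v, w.
(* Nonproducts are matched fiber by fiber, all fibers having the cardinality of [F]. *)
have /choice[b bP] (p : 'cV[F]_n * 'rV[F]_n) : exists b, V 2 *m p.1 = 0 -> (p.2 <= V 1)%MS ->
    set_bij (fiber V u chi p.1 p.2) (fiber V' u' chi' (k p.1) (h p.2)) b.
  have [[Vv wV]|N] := lem (V 2 *m p.1 = 0 /\ (p.2 <= V 1)%MS); last first.
    by exists id => Vv wV; case: N.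
  have inf := fiber_inj flagV uchi bottom top Vv wV.
  have inf' := fiber_inj flagV' uchi' bottom' top' (kV _ Vv) (hV _ wV).
  by have [b bP] := infinite_set_bij Finf inf inf'; exists b.
have bij a : S a -> set_bij (fiber V u chi (a *m chi) (u *m a))
    (fiber V' u' chi' (k (a *m chi)) (h (u *m a))) (b (a *m chi, u *m a)).
  by move=> Sa; apply: (bP (a *m chi, u *m a)); [exact: (thin_col uchi) | exact: (thin_row uchi)].
pose f a := if `[< rank1_product V a >] then e a else b (a *m chi, u *m a) a.
have fprod v w : V 2 *m v = 0 -> (w <= V 1)%MS -> f (v *m w) = k v *m h w.
  move=> Vv wV; rewrite /f asboolT; last by exists v, w.
  exact: eP.
have ffib a : S a -> ~ rank1_product V a ->
    fiber V' u' chi' (k (a *m chi)) (h (u *m a)) (f a).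
  by move=> Sa Na; rewrite /f asboolF //; have [sub _ _] := bij a Sa; apply: sub.
have fP a : S a -> [/\ T (f a), f a *m chi' = k (a *m chi), u' *m f a = h (u *m a) &
    rank1_product V' (f a) <-> rank1_product V a].
  move=> Sa; have [[v [w [Vv wV aE]]]|Na] := lem (rank1_product V a); last first.
    by have [Tfa -> -> Nfa] := ffib a Sa Na; split.
  have [_ va ua] := thin_rank1 flagV uchi Vv wV.
  have [Tfa vfa ufa] := thin_rank1 flagV' uchi' (kV _ Vv) (hV _ wV).
  rewrite aE fprod // va ua k0 h0; split=> //.
  by split=> _; [exists v, w | exists (k v), (h w); split=> //; [exact: kV | exact: hV]].
exists f; split=> [a Sa|]; first by have [] := fP a Sa.
split=> [a a' Sa Sa' E|].
  have [_ va ua Ea] := fP a Sa; have [_ va' ua' Ea'] := fP a' Sa'.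
  have [[v [w [Vv wV aE]]]|Na] := lem (rank1_product V a).
    have /Ea'[v1 [w1 [Vv1 w1V aE']]] : rank1_product V' (f a').
      by rewrite -E; apply/Ea; exists v, w.
    by move: E; rewrite aE aE' !fprod // => E; apply/khP.
  have Na' : ~ rank1_product V a' by rewrite -Ea' -E Ea.
  have vE : a *m chi = a' *m chi.
    by apply: kI; rewrite -?va -?va' ?E //; apply: (thin_col uchi).
  have uE : u *m a = u *m a'.
    by apply: hI; rewrite -?ua -?ua' ?E //; apply: (thin_row uchi).
  have [_ inj _] := bij a Sa; apply: inj; try (apply: mem_set; split=> //).
  by move: E; rewrite /f !asboolF // -vE -uE.
split=> [c Tc|a a' Sa Sa'].
  have [[v [w [Vv wV ->]]]|Nc] := lem (rank1_product V' c).
    have [v1 Vv1 <-] := kS _ Vv; have [w1 w1V <-] := hS _ wV.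
    by exists (v1 *m w1); rewrite ?fprod //; have [] := thin_rank1 flagV uchi Vv1 w1V.
  have [v Vv vE] := kS _ (thin_col uchi' Tc); have [w wV wE] := hS _ (thin_row uchi' Tc).
  have [_ _ surj] := bP (v, w) Vv wV.
  have [|a [Sa va wa Na] ac] := surj c; first by split; rewrite ?vE ?wE.
  by exists a => //; rewrite /f asboolF // va wa.
have [Tfa va _ _] := fP a Sa; have [Tfa' _ ua' _] := fP a' Sa'.
rewrite (thin_mul uchi) // (thin_mul uchi') // va ua' fprod //.
- exact: (thin_col uchi).
- exact: (thin_row uchi).
Qed.

End ExceptionalIso.

(** * Classification *)

Lemma semigroup_iso_inverse (F : fieldType) n (S T : 'M[F]_n -> Prop) :
  (forall a b, S a -> S b -> S (a *m b)) -> semigroup_iso S T ->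
  exists f g, mutually_inverse_iso S T f g.
Proof.
move=> SM [f [fT [finj [fsurj fM]]]].
have /choice[g gP] c : exists a, T c -> S a /\ f a = c.
  have [/fsurj[a Sa fa]|] := lem (T c); first by exists a.
  by exists 0.
exists f, g; split; split=> //; try by move=> c /gP[].
  by move=> a Sa; have [Sg fg] := gP _ (fT a Sa); apply: finj.
move=> c d Tc Td; have [Sc fc] := gP c Tc; have [Sd fd] := gP d Td.
have E : f (g c *m g d) = c *m d by rewrite fM // fc fd.
have [Scd fcd] : S (g (c *m d)) /\ f (g (c *m d)) = c *m d.
  by apply: gP; rewrite -E; apply/fT/SM.
by apply: finj; rewrite // ?E //; apply: SM.
Qed.

Lemma iso_biorthogonal (F : fieldType) n (S T : 'M[F]_n -> Prop) f g j d :
  (forall a b, S a -> S b -> S (a *m b)) -> S 0 -> T 0 ->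
  mutually_inverse_iso S T f g -> biorthogonal S j d -> biorthogonal T j d.
Proof.
move=> SM S0 T0 fg [a [b [Sa Sb ab]]]; have [[fT gfK fM] _] := fg.
have fpower i x : power S i x -> power T i (f x).
  elim: i x => [|i IHi] x /=; first exact: fT.
  move=> [y [z [Sy Sz ->]]]; exists (f y), (f z); split; [exact: IHi|exact: fT|].
  by rewrite fM //; apply: power_sub Sy.
exists (f \o a), (f \o b); split=> [i|i|i k] /=; [exact: fpower|exact: fT|].
have Sai := power_sub SM (Sa i); rewrite -ab -fM //; apply/eqP/eqP => [E|->].
  by rewrite -(gfK (a i *m b k)) ?E; [rewrite (iso0 (mutually_inverse_isoC fg)) | apply: SM].
exact: iso0 fg S0 T0.
Qed.

Section Assembly.
Variables (F : fieldType) (n r : nat) (V V' : nat -> 'M[F]_n).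
Hypotheses (r_gt2 : (2 < r)%N) (flagV : is_flag r V) (flagV' : is_flag r V').

Lemma iso_middle_le (W W' : nat -> 'M[F]_n) f g i :
  is_flag r W -> is_flag r W' -> mutually_inverse_iso (phi r W) (phi r W') f g ->
  (0 < i < r)%N -> (\rank (W i) - \rank (W 1) <= \rank (W' i) - \rank (W' 1))%N.
Proof.
move=> fW fW' fg /andP[i0 ir].
(* The power index is [j = r - i.+1], shifted by one; the condition [j.+1 < r] is [0 < i]. *)
have ij : i = (r - (r - i.+1).+1)%N by lia.
have jr : ((r - i.+1).+1 < r)%N by lia.
have le (X : nat -> 'M[F]_n) : is_flag r X -> (\rank (X 1) <= \rank (X i))%N.
  by move=> fX; rewrite mxrankS // (flag_le fX) // i0 ltnW.
have r1 : (1 < r)%N by apply: ltnW.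
rewrite leq_subRL ?le // addnC {2}ij -(biorthogonalP fW' r1 _ jr).
apply: (iso_biorthogonal _ _ _ fg); [exact: phi_mul | exact: phi0 | exact: phi0 |].
by rewrite (biorthogonalP fW r1 _ jr) -ij subnK ?le.
Qed.

Lemma iso_middle f g i : mutually_inverse_iso (phi r V) (phi r V') f g ->
  (0 < i < r)%N -> (\rank (V i) - \rank (V 1) = \rank (V' i) - \rank (V' 1))%N.
Proof.
move=> fg ir; apply/eqP; rewrite eqn_leq (iso_middle_le flagV flagV' fg) //.
exact: iso_middle_le (mutually_inverse_isoC fg) ir.
Qed.

Lemma flag_rank_lt (W : nat -> 'M[F]_n) i j : is_flag r W -> (i < j <= r)%N ->
  (\rank (W i) < \rank (W j))%N.
Proof.
move=> fW /andP[ij jr]; apply: leq_trans (mxrankS (flag_le fW (i := i.+1) _)).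
  by apply/rank_ltmx/(flag_ltS fW)/(leq_trans ij).
by rewrite ij.
Qed.

Lemma flag_rank_top (W : nat -> 'M[F]_n) : is_flag r W -> \rank (W r) = n.
Proof. by case=> _ [/eqP]. Qed.

(** For [r > 3] there are at least two strict inclusions between [W 1] and [W r.-1]. *)
Lemma wide_or_thin (W : nat -> 'M[F]_n) : is_flag r W ->
  (2 + \rank (W 1) <= \rank (W r.-1))%N \/
  (r = 3 /\ \rank (W 2) = (\rank (W 1)).+1)%N.
Proof.
move=> fW; have lt12 := flag_rank_lt fW (_ : 1 < 2 <= r)%N.
have [r3|r3] := eqVneq r 3%N.
  have {}lt12 : (\rank (W 1) < \rank (W 2))%N by apply: lt12; lia.
  rewrite r3 /=; have [|le] := leqP (2 + \rank (W 1))%N (\rank (W 2%N)); [by left|right].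
  by split=> //; lia.
have lt2 : (\rank (W 2) < \rank (W r.-1))%N by apply: flag_rank_lt => //; lia.
by left; have := lt12 _; lia.
Qed.

(** The extreme ranks are [0] and [n], so [d_1] and the middle dimensions determine the
    signature. *)
Lemma eq_rank_of_iso : (forall i, (0 < i < r)%N ->
    \rank (V i) - \rank (V 1) = \rank (V' i) - \rank (V' 1))%N ->
  \rank (V 1) = \rank (V' 1) -> sig r V = sig r V'.
Proof.
move=> mid eq1; apply/(sig_eqP flagV flagV') => i ir.
have [->|i0] := posnP i; first by rewrite flagV.1 flagV'.1.
have [->|ir'] := eqVneq i r; first by rewrite !flag_rank_top.
have [->//|i1] := eqVneq i 1%N.
have := mid i; have := flag_rank_lt flagV (_ : 1 < i <= r)%N.
by have := flag_rank_lt flagV' (_ : 1 < i <= r)%N; lia.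
Qed.

Lemma wide_iso_eq f g : mutually_inverse_iso (phi r V) (phi r V') f g ->
  (2 + \rank (V 1) <= \rank (V r.-1))%N -> sig r V = sig r V'.
Proof.
move=> fg wide; have mid i := iso_middle fg (i := i).
have r1 : (1 < r)%N by apply: ltnW.
have wide' : (2 + \rank (V' 1) <= \rank (V' r.-1))%N.
  by have := mid r.-1; lia.
apply: eq_rank_of_iso => //; apply/eqP; rewrite eqn_leq.
rewrite (iso_rank1_le flagV flagV' r1 wide wide' fg).
exact: iso_rank1_le (mutually_inverse_isoC fg).
Qed.

Lemma sig_k1lP (W : nat -> 'M[F]_n) : is_flag r W -> sig_k1l (sig r W) <->
  [/\ r = 3, \rank (W 2) = (\rank (W 1)).+1,
      1 < \rank (W 1) & 1 < n - \rank (W 2)]%N.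
Proof.
move=> fW; have top := flag_rank_top fW; have W0 := fW.1; split.
  move=> [k [l [k1 [l1 E]]]]; have r3 : r = 3%N.
    by have := congr1 size E; rewrite size_map size_iota.
  have lt12 : (\rank (W 1) < \rank (W 2))%N by apply: flag_rank_lt fW _; lia.
  by move: E top; rewrite r3 /sig /= W0 subn0 => -[E1 E2 E3] top; split=> //; lia.
move=> [r3 W2 k1 l1]; exists (\rank (W 1)), (n - \rank (W 2))%N; split=> //; split=> //.
move: top; rewrite r3 => top.
by rewrite /sig /= W0 subn0 top W2 subSn // subnn.
Qed.

End Assembly.

Section ThinIso.
Variables (F : fieldType) (n : nat) (V V' : nat -> 'M[F]_n) (f g : 'M[F]_n -> 'M[F]_n).
Hypotheses (flagV : is_flag 3 V) (flagV' : is_flag 3 V').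
Hypotheses (thinV : \rank (V 2) = (\rank (V 1)).+1)
           (thinV' : \rank (V' 2) = (\rank (V' 1)).+1).
Hypothesis fg : mutually_inverse_iso (phi 3 V) (phi 3 V') f g.

Lemma thin_iso_bottom : (\rank (V 1) <= 1)%N -> (\rank (V' 1) <= 1)%N.
Proof.
move=> /(right_lineP flagV thinV) SR; apply/(right_lineP flagV' thinV').
apply: iso_right_line fg _ _ _ SR; [exact: phi0 | exact: phi0 | exact: phi_mul].
Qed.

Lemma thin_iso_top : (n - \rank (V 2) <= 1)%N -> (n - \rank (V' 2) <= 1)%N.
Proof.
move=> /(left_lineP flagV thinV) SL; apply/(left_lineP flagV' thinV').
apply: iso_left_line fg _ _ _ SL; [exact: phi0 | exact: phi0 | exact: phi_mul].
Qed.

End ThinIso.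

Theorem theorem13 (F : fieldType) (n r : nat) (V V' : nat -> 'M[F]_n) :
  (1 <= n)%N -> (2 < r)%N -> is_flag r V -> is_flag r V' ->
  [/\ (~ finite_field F -> sig_k1l (sig r V) ->
        (semigroup_iso (phi r V) (phi r V') <-> sig_k1l (sig r V'))),
      (~ finite_field F -> ~ sig_k1l (sig r V) ->
        (semigroup_iso (phi r V) (phi r V') <-> sig r V = sig r V')) &
      (finite_field F ->
        (semigroup_iso (phi r V) (phi r V') <-> sig r V = sig r V'))].
Proof.
move=> _ r_gt2 flagV flagV'.
have eq_iso : sig r V = sig r V' -> semigroup_iso (phi r V) (phi r V').
  by move=> /(sig_eqP flagV flagV')/(semigroup_iso_of_eq_rank flagV flagV').
have inv : semigroup_iso (phi r V) (phi r V') ->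
    exists f g, mutually_inverse_iso (phi r V) (phi r V') f g.
  by apply: semigroup_iso_inverse; apply: phi_mul.
have k1lV := sig_k1lP r_gt2 flagV; have k1lV' := sig_k1lP r_gt2 flagV'.
have thin' f g : mutually_inverse_iso (phi r V) (phi r V') f g -> r = 3%N ->
    (\rank (V 2) = (\rank (V 1)).+1)%N -> (\rank (V' 2) = (\rank (V' 1)).+1)%N.
  move=> fg r3 tV; have := iso_middle r_gt2 flagV flagV' fg (_ : 0 < 2 < r)%N.
  have := flag_rank_lt flagV' (_ : 1 < 2 <= r)%N; lia.
have of_bottom f g : mutually_inverse_iso (phi r V) (phi r V') f g ->
    (\rank (V 1) = \rank (V' 1))%N -> sig r V = sig r V'.
  move=> fg; apply: eq_rank_of_iso => // i; exact: iso_middle fg.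
have pos (W : nat -> 'M[F]_n) : is_flag r W ->
    (0 < \rank (W 1))%N /\ (\rank (W 2) < n)%N.
  move=> fW; have top := flag_rank_top fW.
  have := flag_rank_lt fW (_ : 0 < 1 <= r)%N; have := flag_rank_lt fW (_ : 2 < r <= r)%N.
  by rewrite top fW.1; split; lia.
have [p1 p2] := pos _ flagV; have [p1' p2'] := pos _ flagV'.
split.
- move=> Finf /k1lV[r3 tV kV lV]; split=> [/inv[f [g fg]]|/k1lV'[_ tV' kV' lV']].
    have tV' := thin' _ _ fg r3 tV; subst r.
    (* The tests are run along the inverse isomorphism: [d_1 = 1] or [d_3 = 1] for [V'] would force
       the same for [V]. *)
    have gf := mutually_inverse_isoC fg; apply/k1lV'; split=> //.
      by have := thin_iso_bottom flagV' flagV tV' tV gf; lia.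
    by have := thin_iso_top flagV' flagV tV' tV gf; lia.
  by subst r; apply: exceptional_iso.
- move=> Finf Nk1l; split=> // /inv[f [g fg]].
  have [wide|[r3 tV]] := wide_or_thin r_gt2 flagV; first exact: wide_iso_eq fg wide.
  apply: of_bottom (fg) _; have tV' := thin' _ _ fg r3 tV; subst r.
  (* Here [d_1 = 1] or [d_3 = 1]. Either equality passes to [V'], and since [d_1 + 1 + d_3 = n] for
     both flags, [d_1] agrees. *)
  have [k1|k1] := leqP (\rank (V 1%N)) 1%N.
    by have := thin_iso_bottom flagV flagV' tV tV' fg k1; lia.
  have [l1|l1] := leqP (n - \rank (V 2%N))%N 1%N; last by case: Nk1l; apply/k1lV.
  by have := thin_iso_top flagV flagV' tV tV' fg l1; lia.
- move=> Ffin; split=> // /inv[f [g fg]].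
  have [wide|[r3 tV]] := wide_or_thin r_gt2 flagV; first exact: wide_iso_eq fg wide.
  apply: of_bottom (fg) _; have tV' := thin' _ _ fg r3 tV; subst r.
  (* Both inequalities give equal [d_3], and then [d_1 = n - 1 - d_3] agrees. *)
  have := finite_iso_top_le Ffin flagV flagV' tV tV' fg.
  have := finite_iso_top_le Ffin flagV' flagV tV' tV (mutually_inverse_isoC fg).
  lia.
Qed.
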